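(* Consider a nondegenerate model of walk with weights $d_{i,j}$, and let $\overline{E_t}$ be its kernel curve. The following facts are equivalent: (1) the curve $\overline{E_t}$ is a genus zero curve; (2) the curve $\overline{E_t}$ is singular; (3) the curve $\overline{E_t}$ has exactly one singularity $\Omega\in\overline{E_t}$; (4) there exists $([a:b],[c:d])\in\overline{E_t}$ such that the discriminants $\Delta_1([x_0:x_1])$ and $\Delta_2([y_0:y_1])$ have a root at $[a:b]\in\mathbb{P}^1(\mathbb{C})$ and at $[c:d]\in\mathbb{P}^1(\mathbb{C})$ respectively; (5) there exists $([a:b],[c:d])\in\overline{E_t}$ such that the discriminants $\Delta_1([x_0:x_1])$ and $\Delta_2([y_0:y_1])$ have a double root at $[a:b]\in\mathbb{P}^1(\mathbb{C})$ and at $[c:d]\in\mathbb{P}^1(\mathbb{C})$ respectively. If these properties are satisfied, then the singular point is $\Omega=([a:b],[c:d])$, where $[a:b]\in\mathbb{P}^1(\mathbb{C})$ is a double root of $\Delta_1([x_0:x_1])$ and $[c:d]\in\mathbb{P}^1(\mathbb{C})$ is a double root of $\Delta_2([y_0:y_1])$. If these properties are not satisfied, then $\overline{E_t}$ is a smooth curve of genus one.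
   Context: Weights: $d_{i,j}\in[0,1]$ for $(i,j)\in\{-1,0,1\}^2$, with $\sum d_{i,j}=1$. The number $t\in\,]0,1[$ is fixed and transcendental over $\mathbb{Q}(d_{i,j})$ (the field generated by all weights). The kernel polynomial is $K(x,y,t)=xy\big(1-t\sum_{i,j}d_{i,j}x^iy^j\big)\in\mathbb{C}[x,y]$. The model is degenerate if $K(x,y,t)$ is reducible in $\mathbb{C}[x,y]$, or has $x$-degree $\le 1$, or has $y$-degree $\le 1$; otherwise it is nondegenerate. The kernel curve is $$\overline{E_t}=\{([x_0:x_1],[y_0:y_1])\in\mathbb{P}^1(\mathbb{C})\times\mathbb{P}^1(\mathbb{C}) : \overline{K}(x_0,x_1,y_0,y_1,t)=0\},$$ $$\overline{K}(x_0,x_1,y_0,y_1,t)=x_0x_1y_0y_1-t\sum_{i,j=0}^2 d_{i-1,j-1}x_0^ix_1^{2-i}y_0^jy_1^{2-j}.$$ A point $([a:b],[c:d])\in\overline{E_t}$ is a singularity if the four partial derivatives $\partial\overline{K}/\partial x_0$, $\partial\overline{K}/\partial x_1$, $\partial\overline{K}/\partial y_0$, $\partial\overline{K}/\partial y_1$ all vanish at $(a,b,c,d)$. The curve is singular if it has at least one singularity, and smooth otherwise. Genus means the (geometric) genus of the irreducible curve $\overline{E_t}$. Write $\overline{K}=\overline{C}_1(x_0,x_1,t)y_1^2+\overline{B}_1(x_0,x_1,t)y_0y_1+\overline{A}_1(x_0,x_1,t)y_0^2=\overline{C}_2(y_0,y_1,t)x_1^2+\overline{B}_2(y_0,y_1,t)x_0x_1+\overline{A}_2(y_0,y_1,t)x_0^2$.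 The discriminants are the degree-four homogeneous forms $\Delta_1([x_0:x_1])=\overline{B}_1^2-4\overline{A}_1\overline{C}_1$ (in $x_0,x_1$) and $\Delta_2([y_0:y_1])=\overline{B}_2^2-4\overline{A}_2\overline{C}_2$ (in $y_0,y_1$). Roots and their multiplicities are understood in $\mathbb{P}^1(\mathbb{C})$. *)

(* Defs.v *)
From HB Require Import structures.
From mathcomp Require Import all_boot all_order all_algebra.
From mathcomp Require Import generic_quotient polyXY.
From mathcomp Require Import reals.
From mathcomp Require Import complex mpoly ring.

Set Implicit Arguments.
Unset Strict Implicit.
Unset Printing Implicit Defensive.

Import Order.TTheory GRing.Theory Num.Theory.

Local Open Scope ring_scope.
Local Open Scope quotient_scope.
Local Open Scope complex_scope.

Section ProjectiveLine.
Variable k : fieldType.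

Definition nonzero_pair := {v : k * k | v != 0}.

Definition proportional (u v : nonzero_pair) : bool :=
  (val u).1 * (val v).2 == (val u).2 * (val v).1.

Lemma proportional_refl : reflexive proportional.
Proof. by move=> u; rewrite /proportional mulrC. Qed.

Lemma proportional_sym : ssrbool.symmetric proportional.
Proof.
by move=> u v; rewrite /proportional eq_sym mulrC [X in _ == X]mulrC.
Qed.

Lemma proportional_trans : transitive proportional.
Proof.
move=> [[v1 v2] /= nz_v] [[u1 u2] /= nz_u] [[w1 w2] /= nz_w].
rewrite /proportional /= => /eqP uv /eqP vw.
rewrite -subr_eq0.
have h1 : v1 * (u1 * w2 - u2 * w1) = 0 by ring: uv vw.
have h2 : v2 * (u1 * w2 - u2 * w1) = 0 by ring: uv vw.
move/eqP: h1; rewrite mulf_eq0 => /orP[/eqP v10|//].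
move/eqP: h2; rewrite mulf_eq0 => /orP[/eqP v20|//].
by case/negP: nz_v; rewrite v10 v20.
Qed.

Canonical proportional_equiv :=
  EquivRel proportional proportional_refl proportional_sym proportional_trans.

Definition P1 := {eq_quot proportional_equiv}.

(* Homogeneous coordinates of a chosen representative of p. The predicates below
   do not depend on this choice: they involve the coordinates only through the
   vanishing of homogeneous forms, or through a linear form up to a scalar. *)
Definition hcoord0 (p : P1) : k := (val (repr p)).1.
Definition hcoord1 (p : P1) : k := (val (repr p)).2.

(* Binary forms, in the homogeneous coordinates 'X_0 and 'X_1. *)
Definition is_root (f : {mpoly k[2]}) (p : P1) : Prop :=
  f.@[tnth [tuple hcoord0 p; hcoord1 p]] = 0.

(* The linear form b x0 - a x1 vanishing at [a : b]. *)
Definition linear_form (p : P1) : {mpoly k[2]} :=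
  hcoord1 p *: 'X_0 - hcoord0 p *: 'X_1.

Definition root_multiplicity (f : {mpoly k[2]}) (p : P1) (m : nat) : Prop :=
  (exists g, f = g * linear_form p ^+ m) /\
  ~ (exists g, f = g * linear_form p ^+ m.+1).

Definition double_root (f : {mpoly k[2]}) (p : P1) : Prop :=
  root_multiplicity f p 2.

End ProjectiveLine.

(* Let F be a function field in one variable over k, embedded in F by iota. The
   points of the smooth projective model of F are the valuation rings of F / k,
   and the genus of F is the dimension over k of the space of differentials that
   are regular at all of these points. *)
Section Genus.
Variables (k F : fieldType) (iota : k -> F).

Definition valuation_ring (O : {pred F}) : Prop :=
  [/\ subring_closed O, forall c, iota c \in O, exists f, f \notin O
    & forall f, f \in O \/ f^-1 \in O].

Record derivation : Type := Derivation {
  derivation_fun :> F -> F;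
  derivationD : {morph derivation_fun : f g / f + g};
  derivationM : forall f g,
    derivation_fun (f * g) = derivation_fun f * g + f * derivation_fun g;
  derivation_const : forall c, derivation_fun (iota c) = 0 }.

(* Der_k(F, F) is the F-linear dual of the module of Kaehler differentials of
   F / k, so that a differential is determined by its pairing with derivations:
   (s_1, s'_1), ..., (s_n, s'_n) represent the sum of the s_i ds'_i, whose value
   at D is the sum of the s_i D(s'_i). *)
Definition differential_of (s : seq (F * F)) (D : derivation) : F :=
  \sum_(p <- s) p.1 * D p.2.

Definition is_differential (w : derivation -> F) : Prop :=
  exists s, w =1 differential_of s.

(* w belongs to the image of the Kaehler differentials of O. *)
Definition regular_at (O : {pred F}) (w : derivation -> F) : Prop :=
  exists2 s, all (fun p => (p.1 \in O) && (p.2 \in O)) s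
           & w =1 differential_of s.

Definition regular_differential (w : derivation -> F) : Prop :=
  is_differential w /\ forall O, valuation_ring O -> regular_at O w.

Definition genus_of_function_field (g : nat) : Prop :=
  exists2 e : 'I_g -> derivation -> F,
    forall i, regular_differential (e i)
  & forall w, regular_differential w ->
      exists! c : 'rV[k]_g, forall D, w D = \sum_i iota (c 0 i) * e i D.

End Genus.

Section AffinePlaneCurves.
Variable k : fieldType.

(* F, with phi : k[x, y] -> F, is the field of fractions of k[x, y] / (p). *)
Definition is_function_field (p : {poly {poly k}}) (F : fieldType)
    (phi : {rmorphism {poly {poly k}} -> F}) : Prop :=
  (forall q, phi q = 0 <-> exists r, q = r * p) /\
  (forall f, exists q r, phi r != 0 /\ f = phi q / phi r).

(* The geometric genus of the closure of the irreducible curve p = 0; the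
   function field exists, and is unique up to isomorphism over k[x, y], as soon
   as p is irreducible. *)
Definition geometric_genus (p : {poly {poly k}}) (g : nat) : Prop :=
  exists (F : fieldType) (phi : {rmorphism {poly {poly k}} -> F}),
    is_function_field p phi /\
    genus_of_function_field (fun c : k => phi c%:P%:P) g.

Definition reducible (p : {poly {poly k}}) : Prop :=
  exists q r, [/\ q \isn't a GRing.unit, r \isn't a GRing.unit & p = q * r].

End AffinePlaneCurves.

Section Transcendence.
Variable R : fieldType.

(* Membership in the smallest subfield of R containing all the d i j. *)
Definition in_generated_field (d : 'I_3 -> 'I_3 -> R) (x : R) : Prop :=
  forall S : {pred R},
    divring_closed S -> (forall i j, d i j \in S) -> x \in S.

Definition transcendental_over (S : R -> Prop) (x : R) : Prop :=
  forall p : {poly R}, (forall i, S p`_i) -> root p x -> p = 0.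

End Transcendence.

Lemma sum3 (V : nmodType) (F : 'I_3 -> V) : \sum_(i < 3) F i = F 0 + F 1 + F 2.
Proof.
rewrite !big_ord_recl big_ord0 addr0 addrA.
by congr (F _ + F _ + F _); apply/val_inj.
Qed.

Lemma ord0E : (0 : 'I_3) = 0%N :> nat. Proof. by []. Qed.
Lemma ord1E : (1 : 'I_3) = 1%N :> nat. Proof. by []. Qed.
Lemma ord2E : (2 : 'I_3) = 2%N :> nat. Proof. by []. Qed.

Lemma comp_mpolyM (n m : nat) (k : comNzRingType) (l : n.-tuple {mpoly k[m]})
    (p q : {mpoly k[n]}) :
  (p * q) \mPo l = (p \mPo l) * (q \mPo l).
Proof. exact: rmorphM. Qed.

(* Indices are shifted by one: for i, j in {0, 1, 2}, d i j stands for the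
   weight d_{i-1,j-1}. *)
Section Kernel.
Variables (k : fieldType) (d : 'I_3 -> 'I_3 -> k) (t : k).

(* The variables x and y of K(x, y) are 'X and 'Y. *)
Definition kernel : {poly {poly k}} :=
  'X * 'Y - t%:P%:P *
    \sum_(i < 3) \sum_(j < 3) (d i j)%:P%:P * 'X ^+ i * 'Y ^+ j.

Definition degenerate_model : Prop :=
  [\/ reducible kernel, (size kernel <= 2)%N | (sizeY kernel <= 2)%N].

Definition nondegenerate_model : Prop := ~ degenerate_model.

(* The variables x0, x1, y0, y1 are, in this order, 'X_0, 'X_1, 'X_2, 'X_3. *)
Definition kernel_hom : {mpoly k[4]} :=
  'X_0 * 'X_1 * 'X_2 * 'X_3 - t *:
    \sum_(i < 3) \sum_(j < 3)
      d i j *: ('X_0 ^+ i * 'X_1 ^+ (2 - i) * 'X_2 ^+ j * 'X_3 ^+ (2 - j)).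

Definition eval4 (f : {mpoly k[4]}) (P : P1 k * P1 k) : k :=
  f.@[tnth [tuple hcoord0 P.1; hcoord1 P.1; hcoord0 P.2; hcoord1 P.2]].

Definition on_curve (P : P1 k * P1 k) : Prop := eval4 kernel_hom P = 0.

Definition singularity (P : P1 k * P1 k) : Prop :=
  on_curve P /\ forall v : 'I_4, eval4 kernel_hom^`M(v) P = 0.

Definition singular_curve : Prop := exists P, singularity P.
Definition smooth_curve : Prop := ~ singular_curve.

(* The curve is the closure of the affine curve K(x, y) = 0. *)
Definition kernel_curve_genus (g : nat) : Prop := geometric_genus kernel g.

(* coef1 j is the coefficient of y0^j y1^(2-j) in kernel_hom, and coef2 i that
   of x0^i x1^(2-i). *)
Definition coef1 (j : 'I_3) : {mpoly k[2]} :=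
  (j == 1 :> nat)%:R * ('X_0 * 'X_1) -
  t *: \sum_(i < 3) d i j *: ('X_0 ^+ i * 'X_1 ^+ (2 - i)).

Definition coef2 (i : 'I_3) : {mpoly k[2]} :=
  (i == 1 :> nat)%:R * ('X_0 * 'X_1) -
  t *: \sum_(j < 3) d i j *: ('X_0 ^+ j * 'X_1 ^+ (2 - j)).

Definition C1 := coef1 0.
Definition B1 := coef1 1.
Definition A1 := coef1 2.
Definition C2 := coef2 0.
Definition B2 := coef2 1.
Definition A2 := coef2 2.

Lemma kernel_hom_y :
  let ev f := f \mPo [tuple 'X_0; 'X_1] in
  kernel_hom = ev C1 * 'X_3 ^+ 2 + ev B1 * 'X_2 * 'X_3 + ev A1 * 'X_2 ^+ 2.
Proof.
rewrite /= /kernel_hom /C1 /B1 /A1 /coef1 !sum3 -!mul_mpolyC.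
rewrite !ord0E !ord1E !ord2E /= !expr0 !expr1 !mul0r !mul1r !mulr1.
rewrite !subn0 !(comp_mpolyB, comp_mpolyD, comp_mpolyM, comp_mpoly0).
rewrite !expr2 !(comp_mpolyM, comp_mpolyC, comp_mpolyXU) /=.
move: 'X_0 'X_1 'X_2 'X_3 t%:MP => x0 x1 y0 y1 c.
ring.
Qed.

Lemma kernel_hom_x :
  let ev f := f \mPo [tuple 'X_2; 'X_3] in
  kernel_hom = ev C2 * 'X_1 ^+ 2 + ev B2 * 'X_0 * 'X_1 + ev A2 * 'X_0 ^+ 2.
Proof.
rewrite /= /kernel_hom /C2 /B2 /A2 /coef2 !sum3 -!mul_mpolyC.
rewrite !ord0E !ord1E !ord2E /= !expr0 !expr1 !mul0r !mul1r !mulr1.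
rewrite !subn0 !(comp_mpolyB, comp_mpolyD, comp_mpolyM, comp_mpoly0).
rewrite !expr2 !(comp_mpolyM, comp_mpolyC, comp_mpolyXU) /=.
move: 'X_0 'X_1 'X_2 'X_3 t%:MP => x0 x1 y0 y1 c.
ring.
Qed.

Definition Delta1 : {mpoly k[2]} := B1 ^+ 2 - 4 * A1 * C1.
Definition Delta2 : {mpoly k[2]} := B2 ^+ 2 - 4 * A2 * C2.

End Kernel.

Definition complex_weights (R : realType) (d : 'I_3 -> 'I_3 -> R) :
  'I_3 -> 'I_3 -> R[i] := fun i j => (d i j)%:C.

(* Main.v *)
Require Import Defs.
From HB Require Import structures.
From mathcomp Require Import all_boot all_order all_algebra.
From mathcomp Require Import generic_quotient ring_quotient fraction.
From mathcomp Require Import polyXY separable boolp.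
From mathcomp Require Import reals complex mpoly.
From mathcomp Require Import ring zify.

(** Write the kernel polynomial as K = A x^2 + B x + C with A, B, C in k[y], and
    let D = B^2 - 4 A C, a polynomial of degree at most 4 whose homogenization is
    the discriminant Delta_2. Transposing the weights exchanges x and y, so that
    every fact about Delta_2 has its counterpart for Delta_1. The theorem rests
    on three facts about D.

    Genus. Since K is irreducible, D is not a square, and the function field of
    the curve is k(y)(z) with z^2 = D, where z = 2 A x + B; if D = h L^2, then z
    can be divided by L, so that z^2 = h ([hyperelliptic_of_quadratic]). When f
    is a binary form of degree 2 g + 2 without multiple root, the everywhere
    regular differentials of the field z^2 = f are the p(y) dy / z with
    deg p < g ([hyperelliptic_genus]). These are regular because f and f' are
    coprime. Conversely, the local rings of the affine curve z^2 = f are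
    valuation rings preserved by the derivation z d/dy, so that h dy / z can only
    be regular if h lies in all of them, hence in k[y, z]; the same condition
    in the chart at infinity eliminates z and bounds the degree of h. Thus the
    genus is 1 if Delta_2 has four distinct roots, and it is 0 if Delta_2 is the
    product of the square of a linear form and a form with two distinct roots.

    Singular points. Along a fibre of the projection to the second factor, K
    is a binary quadratic form in (x0, x1) and D is its discriminant. Comparing
    expansions to first order around this fibre shows that it contains a
    singular point exactly when D vanishes there to order at least two
    ([singularity_jet], [mult_ge2_jet]). A form of degree 4 with two multiple
    roots is a square, hence D has at most one, and the curve has at most one
    singular point.

    Order exactly two. A triple root of D would be a cusp. At a multiple root p
    other than 0 and infinity, the equations D(p) = D'(p) = 0 can be solved for
    t, and eliminating t leaves an algebraic equation for p over the field of the
    weights; so p, and then t, would be algebraic. At 0 and infinity, the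
    three extreme coefficients of D on that side are polynomials in t that cannot
    vanish together when t is transcendental ([no_triple_root]). *)

Set Implicit Arguments.
Unset Strict Implicit.
Unset Printing Implicit Defensive.

Import Order.TTheory GRing.Theory Num.Theory.

Local Open Scope ring_scope.
Local Open Scope quotient_scope.

(** * Reversed polynomials and evaluation in an extension *)

Section Reverse.
Variable k : fieldType.
Implicit Types p q : {poly k}.

(** The form of degree n with dehomogenization p has dehomogenization revp n p
    in the chart around infinity. *)
Definition revp n p : {poly k} := \poly_(i < n.+1) p`_(n - i).

Lemma size_revp n p : (size (revp n p) <= n.+1)%N.
Proof. exact: size_poly. Qed.

Lemma coef_revp n p i : (revp n p)`_i = if (i <= n)%N then p`_(n - i) else 0.
Proof. by rewrite coef_poly ltnS. Qed.

Lemma revpK n p : (size p <= n.+1)%N -> revp n (revp n p) = p.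
Proof.
move=> sp; apply/polyP=> i; rewrite !coef_revp; case: leqP => [le_in|lt_ni].
  by rewrite leq_subr subKn.
by rewrite nth_default // (leq_trans sp).
Qed.

Lemma revp_eq0 n p : (size p <= n.+1)%N -> revp n p = 0 -> p = 0.
Proof.
move=> sp p0; rewrite -(revpK sp) p0; apply/polyP => i.
by rewrite coef_revp !coef0 if_same.
Qed.

End Reverse.

HB.lock Definition eval_x (k F : fieldType) (iota : {rmorphism k -> F}) (x : F) :
  {rmorphism {poly k} -> F} := horner_eval x \o map_poly iota.
Canonical eval_x_unlockable := Unlockable eval_x.unlock.
Arguments eval_x {k F} iota x.

HB.lock Definition eval_xz (k F : fieldType) (iota : {rmorphism k -> F})
    (x z : F) :
  {rmorphism {poly {poly k}} -> F} := horner_eval z \o map_poly (eval_x iota x).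
Canonical eval_xz_unlockable := Unlockable eval_xz.unlock.
Arguments eval_xz {k F} iota x z.

Section Evaluation.
Variables (k F : fieldType) (iota : {rmorphism k -> F}).
Local Notation eval_x := (eval_x iota).
Local Notation eval_xz := (eval_xz iota).

Lemma eval_xC x c : eval_x x c%:P = iota c.
Proof. by rewrite unlock /= map_polyC /= horner_evalE hornerC. Qed.

Lemma eval_xX x : eval_x x 'X = x.
Proof. by rewrite unlock /= map_polyX horner_evalE hornerX. Qed.

Lemma eval_xZ x c p : eval_x x (c *: p) = iota c * eval_x x p.
Proof. by rewrite -mul_polyC rmorphM eval_xC. Qed.

Lemma eval_xzC x z p : eval_xz x z p%:P = eval_x x p.
Proof. by rewrite unlock /= map_polyC /= horner_evalE hornerC. Qed.

Lemma eval_xzX x z : eval_xz x z 'X = z.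
Proof. by rewrite unlock /= map_polyX horner_evalE hornerX. Qed.

Lemma eval_x_sum x (p : {poly k}) n : (size p <= n)%N ->
  eval_x x p = \sum_(i < n) iota p`_i * x ^+ i.
Proof.
move=> sp; rewrite unlock /= horner_evalE (horner_coef_wide x (n := n)).
  by apply: eq_bigr => i _; rewrite coef_map.
by rewrite (leq_trans (size_poly _ _)).
Qed.

Lemma eval_x_revp x n (p : {poly k}) : x != 0 -> (size p <= n.+1)%N ->
  eval_x x p = x ^+ n * eval_x x^-1 (revp n p).
Proof.
move=> x0 sp; rewrite (eval_x_sum x sp) (eval_x_sum _ (size_revp n p)) mulr_sumr.
rewrite (reindex_inj rev_ord_inj) /=; apply: eq_bigr => i _.
rewrite coef_revp subSS -ltnS ltn_ord mulrCA; congr (_ * _).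
by rewrite exprVn -expfB_cond // (negPf x0) add0n -ltnS ltn_ord.
Qed.

End Evaluation.

(** * Function fields of double covers of the line *)

Section Hyperelliptic.
Variables (k F : fieldType) (iota : {rmorphism k -> F}).
Local Notation ev := (eval_x iota).
Local Notation ev2 := (eval_xz iota).

(** F is k(x)(z) with z^2 = f(x), and z is quadratic over k(x). Linear
    independence is asked over k[x] only, which also makes x transcendental. *)
Record hyperelliptic (x z : F) (f : {poly k}) : Prop := Hyperelliptic {
  hyp_sqr : z ^+ 2 = ev x f;
  hyp_free : forall p q, ev x p + ev x q * z = 0 -> p = 0 /\ q = 0;
  hyp_gen : forall h, exists p q r,
    ev x r != 0 /\ h = (ev x p + ev x q * z) / ev x r }.

Section Basic.
Variables (x z : F) (f : {poly k}) (H : hyperelliptic x z f).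

Lemma hyp_eval_eq0 p : (ev x p == 0) = (p == 0).
Proof.
apply/eqP/eqP=> [p0|->]; last by rewrite rmorph0.
by have [] := @hyp_free _ _ _ H p 0; rewrite // p0 rmorph0 mul0r addr0.
Qed.

Lemma hyp_xneq0 : x != 0.
Proof. by rewrite -(eval_xX iota x) hyp_eval_eq0 polyX_eq0. Qed.

Lemma hyp_zneq0 : z != 0.
Proof.
apply/eqP=> z0; have [] := @hyp_free _ _ _ H 0 1.
  by rewrite z0 mulr0 rmorph0 addr0.
by move=> _ /eqP; rewrite oner_eq0.
Qed.

(** Euclidean division by the monic polynomial Z^2 - f. *)
Lemma reduce_mod_relation (q : {poly {poly k}}) :
  exists s P Q, q = s * ('X^2 - f%:P) + (P%:P + Q%:P * 'X).
Proof.
elim/poly_ind: q => [|q c [s [P [Q ->]]]].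
  by exists 0, 0, 0; rewrite !mul0r !addr0.
exists (s * 'X + Q%:P), (c + Q * f), P.
rewrite !rmorphD rmorphM /=.
by ring.
Qed.

Lemma eval_xz_linear p q : ev2 x z (p%:P + q%:P * 'X) = ev x p + ev x q * z.
Proof. by rewrite rmorphD rmorphM !eval_xzC eval_xzX. Qed.

Lemma eval_xz_relation : ev2 x z ('X^2 - f%:P) = 0.
Proof.
by rewrite rmorphB rmorphXn eval_xzX eval_xzC (hyp_sqr H) subrr.
Qed.

(** k[x, z] is the quotient of k[X, Z] by Z^2 - f. *)
Lemma eval_xz_eq0 q : ev2 x z q = 0 -> exists s, q = s * ('X^2 - f%:P).
Proof.
have [s [P [Q ->]]] := reduce_mod_relation q.
rewrite rmorphD rmorphM eval_xz_relation mulr0 add0r eval_xz_linear.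
by case/(hyp_free H)=> -> ->; exists s; rewrite mul0r !addr0.
Qed.

Lemma eval_xz_normal q : exists P Q, ev2 x z q = ev x P + ev x Q * z
  /\ exists s, q = s * ('X^2 - f%:P) + (P%:P + Q%:P * 'X).
Proof.
have [s [P [Q ->]]] := reduce_mod_relation q; exists P, Q; split;
  last by exists s.
by rewrite rmorphD rmorphM eval_xz_relation mulr0 add0r eval_xz_linear.
Qed.

Lemma eval_xz_frac h : exists q r, ev2 x z r != 0 /\ h = ev2 x z q / ev2 x z r.
Proof.
have [p [q [r [r0 ->]]]] := hyp_gen H h.
by exists (p%:P + q%:P * 'X), r%:P; rewrite eval_xz_linear eval_xzC.
Qed.

End Basic.

(** The chart around infinity of the double cover: the coordinates are
    1/x and z/x^n, and the equation is the reversed polynomial. *)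
Lemma hyperelliptic_swap x z (f : {poly k}) n : (size f <= (2 * n).+1)%N ->
  hyperelliptic x z f ->
  hyperelliptic x^-1 (z / x ^+ n) (revp (2 * n) f).
Proof.
move=> sf H; have x0 := hyp_xneq0 H.
have xV0 : x^-1 != 0 by rewrite invr_eq0.
have revE m (p : {poly k}) : (size p <= m.+1)%N ->
    ev x^-1 p = ev x (revp m p) / x ^+ m.
  by move=> sp; rewrite (eval_x_revp _ xV0 sp) invrK exprVn mulrC.
split=> [|p q|h].
- rewrite exprMn (hyp_sqr H) exprVn -exprM mulnC.
  by rewrite (eval_x_revp _ x0 sf) mulrAC divff ?mul1r // expf_neq0.
- set N := (maxn (size p) (size q)).
  have sp : (size p <= N.+1)%N by rewrite leqW // leq_maxl.
  have sq : (size q <= N.+1)%N by rewrite leqW // leq_maxr.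
  rewrite (revE N) // (revE N) // => e0.
  have := @hyp_free _ _ _ H ('X^n * revp N p) (revp N q).
  case=> [|/eqP + /(revp_eq0 sq) ->]; last first.
    by rewrite mulf_eq0 -size_poly_eq0 size_polyXn /= => /eqP /(revp_eq0 sp).
  rewrite rmorphM rmorphXn eval_xX.
  have -> : x ^+ n * ev x (revp N p) + ev x (revp N q) * z =
    x ^+ N * x ^+ n * (ev x (revp N p) / x ^+ N +
      ev x (revp N q) / x ^+ N * (z / x ^+ n)).
    by field; rewrite !expf_neq0.
  by rewrite e0 mulr0.
- have [p [q [r [r0 ->]]]] := hyp_gen H h.
  set N := (maxn (size r) (maxn (size p) (size q))).
  have sp : (size p <= N.+1)%N by rewrite leqW // !leq_max leqnn !orbT.
  have sq : (size q <= N.+1)%N by rewrite leqW // !leq_max leqnn !orbT.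
  have sr : (size r <= N.+1)%N by rewrite leqW // leq_maxl.
  exists ('X^n * revp N p), (revp N q), ('X^n * revp N r).
  move: r0; rewrite !(eval_x_revp _ x0 sp, eval_x_revp _ x0 sq,
    eval_x_revp _ x0 sr).
  rewrite !rmorphM !rmorphXn !eval_xX mulf_eq0 => /norP[_ r0].
  split; first by rewrite mulf_neq0 // expf_neq0.
  rewrite !exprVn; field; rewrite r0 !expf_neq0 //.
Qed.

(** * Derivations and differentials *)

Section Derivations.
Variables (x z : F) (f : {poly k}) (H : hyperelliptic x z f).
Hypothesis two_neq0 : (2%:R : k) != 0.

Lemma two_neq0_ext : (2%:R : F) != 0.
Proof. by rewrite -(rmorph_nat iota) fmorph_eq0. Qed.

Section Der.
Variable D : derivation iota.

Lemma der0 : D 0 = 0.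
Proof. by apply: (addrI (D 0)); rewrite -derivationD !addr0. Qed.

Lemma derV h : h != 0 -> D h^-1 = - D h / h ^+ 2.
Proof.
move=> h0; have := derivationM D h h^-1.
rewrite divff // -(rmorph1 iota) derivation_const => e.
have -> : D h^-1 = (D h / h + h * D h^-1) / h - D h / h ^+ 2 by field.
by rewrite -e mul0r sub0r mulNr.
Qed.

Lemma derX h n : D (h ^+ n) = n%:R * h ^+ n.-1 * D h.
Proof.
case: n => [|n]; first by rewrite expr0 -(rmorph1 iota) derivation_const !mul0r.
elim: n => [|n IH]; first by rewrite !expr1 expr0 !mul1r.
rewrite exprS derivationM IH /= [in RHS]mulrS exprS; ring.
Qed.

Lemma der_eval_x y p : D (ev y p) = ev y p^`() * D y.
Proof.
elim/poly_ind: p => [|p c IH]; first by rewrite deriv0 !rmorph0 mul0r der0.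
rewrite derivD derivM derivX derivC addr0 mulr1 !rmorphD !rmorphM eval_xX eval_xC.
by rewrite derivationD derivationM derivation_const IH; ring.
Qed.

Lemma der_z : D z = ev x f^`() * D x / (2%:R * z).
Proof.
have := der_eval_x x f; rewrite -(hyp_sqr H) derX /= expr1 => <-.
by rewrite mulrC mulKf // mulf_neq0 ?two_neq0_ext // (hyp_zneq0 H).
Qed.

End Der.

(** The derivation z d/dx of k[x, z], lifted to k[X][Z]; its value at z is
    f'/2 because 2 z dz = f' dx. *)
Definition theta_poly (q : {poly {poly k}}) : {poly {poly k}} :=
  'X * map_poly (@deriv k) q + (2%:R^-1 *: f^`())%:P * q^`().

Lemma theta_polyD p q : theta_poly (p + q) = theta_poly p + theta_poly q.
Proof. by rewrite /theta_poly raddfD /= derivD; ring. Qed.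

Lemma map_derivM p q : map_poly (@deriv k) (p * q) =
  map_poly (@deriv k) p * q + p * map_poly (@deriv k) q.
Proof.
apply/polyP=> i; rewrite coefD coef_map !coefM /= raddf_sum -big_split /=.
by apply: eq_bigr => j _; rewrite derivM !coef_map.
Qed.

Lemma theta_polyM p q : theta_poly (p * q) = theta_poly p * q + p * theta_poly q.
Proof. by rewrite /theta_poly map_derivM derivM; ring. Qed.

Lemma theta_polyC c : theta_poly c%:P%:P = 0.
Proof.
by rewrite /theta_poly map_polyC /= !derivC polyC0 !mulr0 addr0.
Qed.

Lemma theta_poly_relation : theta_poly ('X^2 - f%:P) = 0.
Proof.
rewrite /theta_poly [map_poly _ _](_ : _ = - (f^`())%:P); last first.
  apply/polyP=> i; rewrite coef_map coefN coefB !coefC coefXn /=.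
  rewrite derivB -[_%:R]polyC_natr derivC sub0r.
  by case: eqP => // _; rewrite linear0.
have half2 : (2%:R^-1 *: f^`()) *+ 2 = f^`().
  by rewrite -scaler_nat scalerA divff // scale1r.
rewrite derivB derivXn derivC subr0 expr1 mulrnAr -mulrnAl -polyCMn half2.
by ring.
Qed.

End Derivations.
End Hyperelliptic.

Section DerivationExtension.
Variables (k F : fieldType) (iota : k -> F).
Variables (A : comNzRingType) (phi : {rmorphism A -> F}) (del : A -> F).
Hypothesis delD : {morph del : a b / a + b}.
Hypothesis delM : forall a b, del (a * b) = del a * phi b + phi a * del b.
Hypothesis del_ker : forall a, phi a = 0 -> del a = 0.
Hypothesis phi_const : forall c, exists2 a, phi a = iota c & del a = 0.
Hypothesis phi_frac : forall h, exists a b, phi b != 0 /\ h = phi a / phi b.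

(** The quotient rule extends to the fraction field a derivation
    defined on the ring of numerators, provided that it kills the relations. *)
Lemma derivation_extension : exists D : derivation iota,
  forall a b, phi b != 0 ->
    D (phi a / phi b) = (del a * phi b - phi a * del b) / phi b ^+ 2.
Proof.
have del0 : del 0 = 0 by rewrite del_ker // rmorph0.
have delN a : del (- a) = - del a.
  by apply: (addrI (del a)); rewrite -delD !subrr.
have [num numP] := boolp.choice phi_frac.
have [den denP] := boolp.choice numP.
have del1 : del 1 = 0.
  by have := delM 1 1; rewrite !mulr1 rmorph1 mulr1 mul1r => /eqP;
     rewrite -subr_eq0 opprD addrA subrr sub0r oppr_eq0 => /eqP.
pose D h := (del (num h) * phi (den h) - phi (num h) *
  del (den h)) / phi (den h) ^+ 2.
have DE h a b : phi b != 0 -> h = phi a / phi b ->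
    D h = (del a * phi b - phi a * del b) / phi b ^+ 2.
  move=> b0 h_ab; have [n0 h_nd] := denP h.
  rewrite /D; move: (num h) (den h) n0 h_nd => n d d0 h_nd.
  have e : phi (n * b - a * d) = 0.
    rewrite rmorphB !rmorphM.
    have -> : phi n = h * phi d by rewrite h_nd divfK.
    have -> : phi a = h * phi b by rewrite h_ab divfK.
    by ring.
  have := del_ker e; rewrite delD delN !delM => e1.
  move: h_nd; rewrite h_ab => h_nd.
  have nE : phi n = phi a / phi b * phi d by rewrite h_nd divfK.
  have -> : del n = (del a * phi d + phi a * del d - phi n * del b) / phi b.
    apply: (canRL (mulfK b0)); apply/eqP; rewrite -subr_eq0 -e1 -subr_eq0;
      apply/eqP.
    by ring.
  by rewrite nE; field; rewrite b0 d0.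
have DD : {morph D : g h / g + h}.
  move=> g h; have [bg eg] := denP g; have [bh eh] := denP h.
  rewrite (@DE (g + h) (num g * den h + num h * den g) (den g * den h)).
  - rewrite delD !delM rmorphD !rmorphM /D; field.
    by rewrite bg bh.
  - by rewrite rmorphM mulf_neq0.
  - rewrite [in LHS]eg [in LHS]eh rmorphD !rmorphM; field; by rewrite bg bh.
have DM g h : D (g * h) = D g * h + g * D h.
  have [bg eg] := denP g; have [bh eh] := denP h.
  rewrite (@DE (g * h) (num g * num h) (den g * den h)).
  - rewrite !delM !rmorphM /D.
    move: (num g) (den g) (num h) (den h) bg bh eg eh => a b c d b0 d0 -> ->.
    by field; rewrite b0 d0.
  - by rewrite rmorphM mulf_neq0.
  - rewrite [in LHS]eg [in LHS]eh !rmorphM; field; by rewrite bg bh.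
have Dc c : D (iota c) = 0.
  have [a ac a0] := phi_const c.
  rewrite (@DE _ a 1) ?rmorph1 ?oner_eq0 // ?divr1 //.
  by rewrite a0 del1 mul0r mulr0 subrr mul0r.
by exists (Defs.Derivation DD DM Dc) => a b b0; apply: DE.
Qed.

End DerivationExtension.

Section Theta.
Variables (k F : fieldType) (iota : {rmorphism k -> F}).
Local Notation ev := (eval_x iota).
Local Notation ev2 := (eval_xz iota).
Variables (x z : F) (f : {poly k}) (H : hyperelliptic iota x z f).
Hypothesis two_neq0 : (2%:R : k) != 0.

(** The derivation z d/dx of the function field, with the formula that
    shows that it preserves every local ring of the affine curve. *)
Lemma theta_exists : exists D : derivation iota, D x = z /\
  forall q r, ev2 x z r != 0 -> D (ev2 x z q / ev2 x z r) =
    ev2 x z (theta_poly f q * r - q * theta_poly f r) / ev2 x z r ^+ 2.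
Proof.
have [] := @derivation_extension k F iota _ (ev2 x z)
  (fun q => ev2 x z (theta_poly f q)).
- by move=> a b; rewrite theta_polyD rmorphD.
- by move=> a b; rewrite theta_polyM rmorphD !rmorphM.
- move=> a /(eval_xz_eq0 H)[s ->].
  by rewrite theta_polyM theta_poly_relation // mulr0 addr0 rmorphM
    (eval_xz_relation H) mulr0.
- by move=> c; exists c%:P%:P; rewrite ?eval_xzC ?eval_xC // theta_polyC rmorph0.
- exact: eval_xz_frac H.
move=> D DE; exists D; split=> [|q r r0]; last first.
  by rewrite DE // rmorphB !rmorphM.
have tX : theta_poly f 'X%:P = 'X.
  by rewrite /theta_poly map_polyC /= derivX derivC mulr0 addr0 polyC1 mulr1.
have t1 : theta_poly f 1 = 0 by rewrite -(theta_polyC f 1) !polyC1.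
have := DE 'X%:P 1; rewrite t1 tX rmorph0 mulr0 subr0 rmorph1 !mulr1.
by rewrite !expr1n !divr1 eval_xzX eval_xzC eval_xX; apply; rewrite oner_eq0.
Qed.

Lemma der_unique (D D' : derivation iota) : D x = D' x -> D =1 D'.
Proof.
move=> Dx h; have [p [q [r [r0 ->]]]] := hyp_gen H h.
rewrite !derivationM !derV // !derivationD !derivationM !der_eval_x.
by rewrite !(der_z H) // Dx.
Qed.

(** Derivations of F that kill k form a space of dimension one over F: they
    are determined by their value at x. *)
Lemma der_scale (D D' : derivation iota) h : D' x != 0 ->
  D h = D' h * (D x / D' x).
Proof.
move=> Dx; have [p [q [r [r0 ->]]]] := hyp_gen H h.
rewrite !derivationM !derV // !derivationD !derivationM !der_eval_x.
rewrite !(der_z H) //; field.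
by rewrite r0 (hyp_zneq0 H) (two_neq0_ext iota two_neq0) Dx.
Qed.

(** Hence a differential is determined by its value at a single
    nonzero derivation. Taking z d/dx for the latter identifies the
    differential h dx/z with h. *)
Lemma differential_scale (D D' : derivation iota) w : is_differential w ->
  D' x != 0 -> w D = w D' * (D x / D' x).
Proof.
move=> [s ws] Dx; rewrite !ws /differential_of mulr_suml.
by apply: eq_bigr => p _; rewrite (der_scale D _ Dx) mulrA.
Qed.

(** * Local rings of an affine double cover *)

Definition local_ring (x z : F) (a c : k) : {pred F} := fun h =>
  `[< exists q r : {poly {poly k}},
      r.[c%:P].[a] != 0 /\ h = ev2 x z q / ev2 x z r >].

Section Point.
Variables (a c : k).
Hypothesis ac : c ^+ 2 = f.[a].
Local Notation O := (local_ring x z a c).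

Lemma local_ringP h : reflect (exists q r : {poly {poly k}},
  r.[c%:P].[a] != 0 /\ h = ev2 x z q / ev2 x z r) (h \in O).
Proof. exact: asboolP. Qed.

(** Evaluation at a point of the curve is well defined on k[x, z]. *)
Lemma at_point_eq (q r : {poly {poly k}}) : ev2 x z q = ev2 x z r ->
  q.[c%:P].[a] = r.[c%:P].[a].
Proof.
move/eqP; rewrite -subr_eq0 -rmorphB => /eqP /(eval_xz_eq0 H)[s e].
by rewrite -[q](subrK r) e !hornerE -?expr2 ac subrr mulr0 add0r.
Qed.

Lemma at_point_neq0 (q : {poly {poly k}}) : q.[c%:P].[a] != 0 -> ev2 x z q != 0.
Proof.
apply: contraNneq => e; rewrite (@at_point_eq q 0) ?rmorph0 //.
by rewrite !horner0.
Qed.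

Lemma local_subring : subring_closed O.
Proof.
split.
- by apply/local_ringP; exists 1, 1; rewrite !hornerE oner_eq0 rmorph1 divr1.
- move=> _ _ /local_ringP[q [r [r0 ->]]] /local_ringP[q' [r' [r'0 ->]]].
  apply/local_ringP; exists (q * r' - q' * r), (r * r').
  rewrite !hornerM mulf_neq0 // rmorphB !rmorphM; split=> //.
  by field; rewrite !at_point_neq0.
- move=> _ _ /local_ringP[q [r [r0 ->]]] /local_ringP[q' [r' [r'0 ->]]].
  apply/local_ringP; exists (q * q'), (r * r').
  rewrite !hornerM mulf_neq0 // !rmorphM; split=> //.
  by field; rewrite !at_point_neq0.
Qed.

Lemma local_poly q : ev2 x z q \in O.
Proof.
by apply/local_ringP; exists q, 1; rewrite !hornerE oner_eq0 rmorph1 divr1.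
Qed.

Lemma local_proper : exists h, h \notin O.
Proof.
exists (x - iota a)^-1; apply/negP => /local_ringP[q [r [r0 e]]].
have xa : x - iota a = ev2 x z ('X - a%:P)%:P.
  by rewrite eval_xzC rmorphB eval_xX eval_xC.
have xa0 : x - iota a != 0.
  by rewrite xa eval_xzC (hyp_eval_eq0 H) polyXsubC_eq0.
have e2 : ev2 x z r = ev2 x z (q * ('X - a%:P)%:P).
  rewrite rmorphM -xa.
  have -> : ev2 x z q = (x - iota a)^-1 * ev2 x z r.
    by rewrite e divfK // at_point_neq0.
  by rewrite mulrAC mulVf // mul1r.
by move: r0; rewrite (at_point_eq e2) !hornerE subrr mulr0 eqxx.
Qed.

Lemma theta_local (D : derivation iota) h : D x = z -> h \in O -> D h \in O.
Proof.
move=> Dx; have [D' [D'x D'E]] := theta_exists.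
rewrite (der_unique (D' := D')) ?D'x // => /local_ringP[q [r [r0 ->]]].
rewrite D'E ?at_point_neq0 //; apply/local_ringP.
by exists (theta_poly f q * r - q * theta_poly f r), (r ^+ 2);
  rewrite !horner_exp expf_neq0 // rmorphXn.
Qed.

(** If h dx/z is regular at a point, then h belongs to its local ring,
    because z d/dx preserves this ring. *)
Lemma local_regular (D : derivation iota) w : D x = z -> regular_at O w ->
  w D \in O.
Proof.
move=> Dx [s /allP sO ->]; rewrite /differential_of.
have [O1 OB OM] := local_subring.
have O0 : 0 \in O by rewrite -(subrr 1) OB.
have OD u v : u \in O -> v \in O -> u + v \in O.
  by move=> uO vO; rewrite -[v]opprK OB // -sub0r OB.
rewrite big_seq; elim/big_rec: _ => // p h ps hO.
have /andP[p1 p2] := sO _ ps.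
by apply: OD => //; apply: OM => //; apply: theta_local.
Qed.

End Point.

End Theta.

Lemma closed_sqrt (k : closedFieldType) (a : k) : exists c, c ^+ 2 = a.
Proof.
have [c] := @solve_monicpoly k 2 (fun i => if i == 0%N then a else 0) isT.
by rewrite !big_ord_recl big_ord0 /= mul0r !addr0 expr0 mulr1; exists c.
Qed.

Section LocalRings.
Variables (k : closedFieldType) (F : fieldType) (iota : {rmorphism k -> F}).
Local Notation ev := (eval_x iota).
Local Notation ev2 := (eval_xz iota).
Hypothesis two_neq0 : (2%:R : k) != 0.

Section Curve.
Variables (x z : F) (f : {poly k}) (H : hyperelliptic iota x z f).
Hypothesis f_sep : separable_poly f.

Section Point.
Variables (a c : k).
Hypothesis ac : c ^+ 2 = f.[a].
Local Notation O := (local_ring iota x z a c).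

Lemma horner_eq0_factor (p : {poly k}) : p.[a] = 0 ->
  exists q, p = q * ('X - a%:P).
Proof. by move/rootP/factor_theorem. Qed.

Lemma at_point_linear (p q : {poly k}) : (p%:P + q%:P * 'X).[c%:P].[a] =
  p.[a] + q.[a] * c.
Proof. by rewrite !hornerE. Qed.

(** The curve is smooth at its ramification points because f has no
    multiple root. *)
Lemma simple_root_cofactor f1 : f = f1 * ('X - a%:P) -> f1.[a] != 0.
Proof. by move=> fE; move: f_sep; rewrite fE separable_root => /andP[]. Qed.

Definition local_unit (u : F) := exists q r : {poly {poly k}},
  [/\ q.[c%:P].[a] != 0, r.[c%:P].[a] != 0 & u = ev2 x z q / ev2 x z r].

Lemma local_unitP q : q.[c%:P].[a] != 0 -> local_unit (ev2 x z q).
Proof.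
by move=> q0; exists q, 1; rewrite rmorph1 divr1 !hornerE oner_eq0.
Qed.

Lemma local_unitM u v : local_unit u -> local_unit v -> local_unit (u * v).
Proof.
move=> [q [r [q0 r0 ->]]] [q' [r' [q'0 r'0 ->]]].
exists (q * q'), (r * r'); rewrite !hornerM !mulf_neq0 //; split=> //.
by rewrite !rmorphM; field; rewrite !(at_point_neq0 H ac).
Qed.

Lemma local_unitV u : local_unit u -> local_unit u^-1.
Proof. by move=> [q [r [q0 r0 ->]]]; exists r, q; rewrite invf_div. Qed.

Lemma local_unit_local u : local_unit u -> u \in O.
Proof. by move=> [q [r [q0 r0 ->]]]; apply/local_ringP; exists q, r. Qed.

(** Every nonzero element of k[x, z] is a power of the uniformizer times
    a unit of the local ring. The uniformizer is x - a at an unramified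
    point, and z at a ramification point. *)
Lemma local_uniformizer : exists2 pi : F, pi != 0 /\ pi \in O &
  forall p q : {poly k}, ev x p + ev x q * z != 0 ->
    exists n u, local_unit u /\ ev x p + ev x q * z = pi ^+ n * u.
Proof.
have reduce pi : (exists n u, local_unit u /\ x - iota a = pi ^+ n * u) ->
    (forall p q : {poly k}, p.[a] != 0 \/ q.[a] != 0 ->
      exists n u, local_unit u /\ ev x p + ev x q * z = pi ^+ n * u) ->
    forall p q : {poly k}, ev x p + ev x q * z != 0 ->
      exists n u, local_unit u /\ ev x p + ev x q * z = pi ^+ n * u.
  move=> [n0 [u0 [u0U xaE]]] pq p q.
  elim/ltn_ind: (size p + size q)%N {-2}p {-2}q (erefl (size p + size q)%N).
  move=> N IH {}p {}q sN pq0.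
  have [pa|pa] := eqVneq p.[a] 0; last by apply: pq; left.
  have [qa|qa] := eqVneq q.[a] 0; last by apply: pq; right.
  have [p1 pE] := horner_eq0_factor pa; have [q1 qE] := horner_eq0_factor qa.
  have e : ev x p + ev x q * z = (ev x p1 + ev x q1 * z) * (x - iota a).
    by rewrite pE qE !rmorphM rmorphB eval_xX eval_xC; ring.
  have [|//||n [u [uU uE]]] := IH (size p1 + size q1)%N _ p1 q1.
  - have sX (r : {poly k}) : (r != 0) ->
        size (r * ('X - a%:P)) = (size r).+1.
      by move=> r0; rewrite size_Mmonic ?monicXsubC // size_XsubC addn2.
    rewrite -sN pE qE.
    have [p10|p10] := eqVneq p1 0; have [q10|q10] := eqVneq q1 0.
    + by move: pq0; rewrite e p10 q10 !rmorph0 mul0r addr0 mul0r eqxx.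
    + by rewrite p10 mul0r !sX // addnS.
    + by rewrite q10 mul0r !sX // addSn.
    + by rewrite !sX // addSn addnS ltnS leqnSn.
  - by apply: contraNneq pq0 => e0; rewrite e e0 mul0r.
  exists (n + n0)%N, (u * u0); split; first exact: local_unitM.
  by rewrite e uE xaE exprD; ring.
have unit1 p q : p.[a] + q.[a] * c != 0 ->
    local_unit (ev x p + ev x q * z).
  by move=> pq; rewrite -eval_xz_linear; apply: local_unitP;
    rewrite at_point_linear.
have unitx p : p.[a] != 0 -> local_unit (ev x p).
  by move=> pa; rewrite -[ev x p]addr0 -(mul0r z) -(rmorph0 (ev x));
     apply: unit1; rewrite horner0 mul0r addr0.
have xaE : x - iota a = ev x ('X - a%:P) by rewrite rmorphB eval_xX eval_xC.
have xa0 : x - iota a != 0 by rewrite xaE (hyp_eval_eq0 H) polyXsubC_eq0.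
have u1 : local_unit 1 by rewrite -(rmorph1 (ev x)); apply: unitx;
  rewrite hornerC oner_eq0.
(* At a ramification point, x - a = z^2 / f1 with f1 a unit. *)
have [c0|c0] := eqVneq c 0.
  have fa : f.[a] = 0 by rewrite -ac c0 expr0n.
  have [f1 fE] := horner_eq0_factor fa.
  have f1a : f1.[a] != 0 := simple_root_cofactor fE.
  have z2 : x - iota a = z ^+ 2 * (ev x f1)^-1.
    rewrite (hyp_sqr H) fE rmorphM -xaE mulrAC divff ?mul1r //.
    by rewrite (hyp_eval_eq0 H); apply: contraNneq f1a => ->; rewrite horner0.
  exists z.
    split; first exact: hyp_zneq0 H.
    by have := local_poly iota x z a c 'X; rewrite eval_xzX.
  apply: reduce => [|p q pq].
    by exists 2, (ev x f1)^-1; split=> //; apply: local_unitV; apply: unitx.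
  have [pa|pa] := eqVneq p.[a] 0; last first.
    exists 0, (ev x p + ev x q * z); rewrite expr0 mul1r; split=> //.
    by apply: unit1; rewrite c0 mulr0 addr0.
  have qa : q.[a] != 0 by case: pq; rewrite ?pa ?eqxx.
  have [p1 pE] := horner_eq0_factor pa.
  exists 1%N, ((ev x (q * f1) + ev x p1 * z) * (ev x f1)^-1); split.
    apply: local_unitM; last by apply: local_unitV; apply: unitx.
    by apply: unit1; rewrite c0 mulr0 addr0 hornerM mulf_neq0.
  rewrite pE !rmorphM -xaE z2 expr1; field.
  by rewrite (hyp_eval_eq0 H); apply: contraNneq f1a => ->; rewrite horner0.
exists (x - iota a).
  split=> //.
  by have := local_poly iota x z a c ('X - a%:P)%:P; rewrite eval_xzC -xaE.
apply: reduce => [|p q pq]; first by exists 1%N, 1; rewrite expr1 mulr1.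
have [pqc|pqc] := eqVneq (p.[a] + q.[a] * c) 0; last first.
  exists 0%N, (ev x p + ev x q * z); rewrite expr0 mul1r; split=> //.
  exact: unit1.
have pE : p.[a] = - (q.[a] * c) by apply/eqP; rewrite -addr_eq0 pqc.
have qa : q.[a] != 0.
  by case: pq => // pa; apply: contraNneq pa => qa; rewrite pE qa mul0r oppr0.
(* p + q z vanishes at the point, so its conjugate p - q z does not; hence
   p + q z is the norm N, a polynomial in x, divided by a unit. *)
have conj_unit : local_unit (ev x p + ev x (- q) * z).
  apply: unit1; rewrite pE hornerN mulNr -opprD oppr_eq0 -mulr2n -mulr_natl.
  by rewrite !mulf_neq0.
pose N := p ^+ 2 - q ^+ 2 * f.
have NE : ev x N = (ev x p + ev x q * z) * (ev x p + ev x (- q) * z).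
  by rewrite /N !expr2 rmorphB !rmorphM -(hyp_sqr H) rmorphN; ring.
have N0 : N != 0.
  rewrite -(hyp_eval_eq0 H) NE mulf_neq0 //.
    apply/eqP=> /(hyp_free H)[_ q0].
    by rewrite q0 horner0 eqxx in qa.
  apply/eqP=> /(hyp_free H)[_ /eqP]; rewrite oppr_eq0 => /eqP q0.
  by rewrite q0 horner0 eqxx in qa.
have [m [g gaP gE]] := multiplicity_XsubC N a.
have ga : g.[a] != 0 by rewrite N0 /= in gaP.
exists m, (ev x g / (ev x p + ev x (- q) * z)); split.
  by apply: local_unitM; [exact: unitx|exact: local_unitV].
rewrite mulrA xaE -rmorphXn -rmorphM [_ * g]mulrC -gE NE mulfK //.
apply/eqP=> /(hyp_free H)[_ /eqP]; rewrite oppr_eq0 => /eqP q0.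
by rewrite q0 horner0 eqxx in qa.
Qed.

(** A quotient of powers of the uniformizer lies in the local ring, or its
    inverse does. *)
Lemma local_valuation : valuation_ring iota O.
Proof.
have O_sub := local_subring H ac; have [O1 OB OM] := O_sub.
split=> //.
- by move=> b; have := local_poly iota x z a c b%:P%:P; rewrite eval_xzC eval_xC.
- exact: local_proper H _ _ ac.
have [pi [pi0 piO] piP] := local_uniformizer.
have factor q : ev2 x z q != 0 ->
  exists n u, local_unit u /\ ev2 x z q = pi ^+ n * u.
  by have [P [Q [-> _]]] := eval_xz_normal H q; apply: piP.
move=> h; have [q [r [r0 ->]]] := eval_xz_frac H h.
have [q0|q0] := eqVneq (ev2 x z q) 0.
  by left; rewrite q0 mul0r -(subrr 1) OB.
have [n [u [uU ->]]] := factor q q0; have [m [v [vU ->]]] := factor r r0.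
have u0 : u != 0 by case: uU => q' [r' [q'0 r'0 ->]];
  rewrite mulf_neq0 ?invr_eq0 ?(at_point_neq0 H ac).
have v0 : v != 0 by case: vU => q' [r' [q'0 r'0 ->]];
  rewrite mulf_neq0 ?invr_eq0 ?(at_point_neq0 H ac).
have piXO j : pi ^+ j \in O by elim: j => [|j IH]; rewrite ?expr0 // exprS OM.
wlog le_mn : n m u v uU vU u0 v0 / (m <= n)%N.
  move=> W; case: (leqP m n) => [/W|/ltnW le]; first by apply.
  by have [||||||] := W m n v u; rewrite ?invf_div //; [right|left].
left.
have -> : pi ^+ n * u / (pi ^+ m * v) = pi ^+ (n - m) * (u / v).
  rewrite -{1}(subnK le_mn) exprD; field.
  by rewrite v0 expf_neq0.
by rewrite OM // local_unit_local //; apply: local_unitM => //;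
  apply: local_unitV.
Qed.

End Point.
End Curve.
End LocalRings.

(** * The genus of a double cover *)

Section Genus.
Variables (k : closedFieldType) (F : fieldType) (iota : {rmorphism k -> F}).
Local Notation ev := (eval_x iota).
Local Notation ev2 := (eval_xz iota).
Hypothesis two_neq0 : (2%:R : k) != 0.

Section Curve.
Variables (x z : F) (f : {poly k}) (H : hyperelliptic iota x z f).
Hypothesis f_sep : separable_poly f.

(** If r vanishes at a, then (p + q z)/r can only be regular at a point above
    a where its numerator vanishes. *)
Lemma local_numerator a c p q r : c ^+ 2 = f.[a] -> r.[a] = 0 -> ev x r != 0 ->
  (ev x p + ev x q * z) / ev x r \in local_ring iota x z a c ->
  p.[a] + q.[a] * c = 0.
Proof.
move=> ac ra r0 /local_ringP[s [t [t0 e]]].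
have t0F := at_point_neq0 H ac t0.
have e2 : ev2 x z ((p%:P + q%:P * 'X) * t) = ev2 x z (r%:P * s).
  rewrite !rmorphM eval_xz_linear eval_xzC -[X in X * ev2 x z t](divfK r0) e;
    field.
  by [].
have := at_point_eq H ac e2.
rewrite !hornerM at_point_linear hornerC ra mul0r => /eqP.
by rewrite mulf_eq0 (negPf t0) orbF => /eqP.
Qed.

(** k[x, z] is the intersection of its local rings. In a fraction
    (p + q z)/r, any root a of r is also a root of p and of q: evaluate the
    numerator at the points above a, and cancel x - a. *)
Lemma integral_everywhere h :
  (forall a c, c ^+ 2 = f.[a] -> h \in local_ring iota x z a c) ->
  exists p q, h = ev x p + ev x q * z.
Proof.
move=> hO; have [p [q [r [+ e]]]] := hyp_gen H h.
elim/ltn_ind: (size r) {-2}r (erefl (size r)) p q e => n IH {}r sr p q e r0.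
have rn0 : r != 0 by rewrite -(hyp_eval_eq0 H).
have [sr1|sr1] := eqVneq (size r) 1%N.
  have [b b0 rE] : exists2 b, b != 0 & r = b%:P.
    by apply/size_poly1P; rewrite sr1.
  exists (b^-1 *: p), (b^-1 *: q); rewrite e rE eval_xC !eval_xZ fmorphV.
  by field; rewrite fmorph_eq0.
have /closed_rootP[a ra] := sr1.
have [c ac] := closed_sqrt f.[a].
have ra0 : r.[a] = 0 by apply/rootP.
have num c' : c' ^+ 2 = f.[a] -> p.[a] + q.[a] * c' = 0.
  by move=> ac'; apply: (local_numerator ac' ra0 r0); rewrite -e hO.
have pqc := num c ac.
have xaE : x - iota a = ev x ('X - a%:P) by rewrite rmorphB eval_xX eval_xC.
have xa0 : x - iota a != 0 by rewrite xaE (hyp_eval_eq0 H) polyXsubC_eq0.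
have [r1 rE] := horner_eq0_factor ra0.
have r10 : ev x r1 != 0.
  by apply: contraNneq r0 => e0; rewrite rE rmorphM e0 mul0r.
(* If c is not 0, use both points (a, c) and (a, - c). If c = 0, then p(a) = 0;
   write x - a = z^2 / f1 and cancel z to get q(a) = 0 as well. *)
have [pa qa] : p.[a] = 0 /\ q.[a] = 0.
  have [c0|c0] := eqVneq c 0; last first.
    have := num (- c); rewrite sqrrN => /(_ ac) pqNc.
    have : 2%:R * c * q.[a] = 0.
      have -> : 2%:R * c * q.[a] = (p.[a] + q.[a] * c) - (p.[a] +
        q.[a] * - c) by ring.
      by rewrite pqc pqNc subrr.
    move/eqP; rewrite !mulf_eq0 (negPf two_neq0) (negPf c0) /= => /eqP qa.
    by move: pqc; rewrite qa mul0r addr0.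
  have pa : p.[a] = 0 by move: pqc; rewrite c0 mulr0 addr0.
  have [p1 pE] := horner_eq0_factor pa.
  have [f1 fE] : exists f1, f = f1 * ('X - a%:P).
    by apply: horner_eq0_factor; rewrite -ac c0 expr0n.
  have f1a := simple_root_cofactor f_sep fE.
  have /local_ringP[s [t [t0 e']]] := hO a c ac.
  have t0F := at_point_neq0 H ac t0.
  have f10 : ev x f1 != 0.
    by rewrite (hyp_eval_eq0 H); apply: contraNneq f1a => ->; rewrite horner0.
  have z2 : z ^+ 2 = ev x f1 * (x - iota a) by rewrite (hyp_sqr H) fE rmorphM xaE.
  have e2 : ev2 x z (((q * f1)%:P + p1%:P * 'X) * t) = ev2 x z (r1%:P * s * 'X).
    rewrite rmorphM eval_xz_linear !(rmorphM (ev2 x z)) eval_xzC eval_xzX rmorphM.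
    have sE : ev2 x z s = h * ev2 x z t by rewrite e' divfK.
    rewrite sE e pE rE !rmorphM -xaE.
    have zE : x - iota a = z ^+ 2 / ev x f1 by rewrite z2 mulrC mulKf.
    rewrite zE; field; rewrite f10 r10 (hyp_zneq0 H) //.
  have := at_point_eq H ac e2.
  rewrite [in RHS]hornerM [in RHS]hornerM hornerX hornerC c0 mulr0.
  rewrite !hornerM at_point_linear mulr0 addr0 hornerM => /eqP.
  rewrite c0 in t0.
  by rewrite !mulf_eq0 (negPf t0) (negPf f1a) !orbF => /eqP.
have [p1 pE] := horner_eq0_factor pa; have [q1 qE] := horner_eq0_factor qa.
apply: (IH (size r1) _ r1 erefl p1 q1) => //.
  rewrite -sr rE size_Mmonic ?monicXsubC //; last first.
    by apply: contraNneq rn0 => r1z; rewrite rE r1z mul0r.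
  by rewrite size_XsubC addn2.
rewrite e pE qE rE !rmorphM -xaE; field.
by rewrite r10 xa0.
Qed.

Lemma regular_coordinates (D : derivation iota) (w : derivation iota -> F) :
  D x = z -> regular_differential w -> exists p q, w D = ev x p + ev x q * z.
Proof.
move=> Dx [_ wO]; apply: integral_everywhere => a c ac.
apply: (local_regular H two_neq0 ac Dx).
apply: wO.
exact: (local_valuation two_neq0 H f_sep ac).
Qed.

(** If u f + v f' = 1, then dx/z = u z dx + 2 v dz, so that dx/z is regular
    wherever x and z are. *)
Lemma regular_on_chart O p : valuation_ring iota O -> x \in O ->
  regular_at O (fun D : derivation iota => ev x p * D x / z).
Proof.
move=> [[O1 OB OM] Oc _ OV] xO.
have O0 : 0 \in O by rewrite -(subrr 1) OB.
have OD u v : u \in O -> v \in O -> u + v \in O.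
  by move=> uO vO; rewrite -[v]opprK OB // -sub0r OB.
have evO q : ev x q \in O.
  elim/poly_ind: q => [|q c IH]; first by rewrite rmorph0.
  by rewrite rmorphD rmorphM eval_xX eval_xC OD // OM.
have zO : z \in O.
  have [//|zVO] := OV z.
  by rewrite -[z](mulfK (hyp_zneq0 H)) -expr2 (hyp_sqr H) OM.
have /Bezout_eq1_coprimepP[[u v] /= uv] : coprimep f f^`().
  by move: f_sep; rewrite separable_poly.unlock.
exists [:: (ev x (p * u) * z, x); (ev x (p * v) * 2%:R, z)] => [|D].
  rewrite /= !(evO, zO, xO, OM) //=.
  by rewrite -(rmorph_nat iota) Oc.
rewrite /differential_of !big_cons big_nil /= (der_z H two_neq0).
have z0 := hyp_zneq0 H; have two0 := two_neq0_ext iota two_neq0.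
have -> : ev x p = ev x p * ev x (u * f + v * f^`()) by rewrite uv rmorph1 mulr1.
rewrite rmorphD !rmorphM -(hyp_sqr H); field.
by rewrite two0 z0.
Qed.

End Curve.

(** The forms x^i dx/z with i < g are a basis of the regular
    differentials. In the chart around infinity, x^i dx/z becomes
    - X^(g - 1 - i) dX/Z with X = 1/x. *)
Theorem hyperelliptic_genus x z f g : hyperelliptic iota x z f ->
  (size f <= (2 * g.+1).+1)%N -> separable_poly f ->
  separable_poly (revp (2 * g.+1) f) -> genus_of_function_field iota g.
Proof.
move=> H sf f_sep r_sep.
have H' := hyperelliptic_swap sf H.
have x0 := hyp_xneq0 H; have z0 := hyp_zneq0 H.
have [D [Dx _]] := theta_exists H two_neq0.
have [D' [D'x _]] := theta_exists H' two_neq0.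
exists (fun i D => ev x 'X^i * D x / z) => [i|w wR].
  split=> [|O OV].
    exists [:: (ev x 'X^i / z, x)] => E.
    by rewrite /differential_of big_seq1 mulrAC.
  have [xO|xVO] : x \in O \/ x^-1 \in O by case: (OV) => _ _ _; apply.
    exact: (regular_on_chart H f_sep _ OV xO).
  have [s sO sE] := regular_on_chart H' r_sep (- 'X^(g - i.+1)) OV xVO.
  exists s => // E; rewrite -sE rmorphN !rmorphXn !eval_xX derV // !exprVn.
  have -> : x ^+ g.+1 = x ^+ i * x ^+ (g - i.+1) * x ^+ 2.
    by rewrite -!exprD; congr (_ ^+ _); have := ltn_ord i; lia.
  by field; rewrite x0 z0 !expf_neq0.
have wE E : w E = w D * (E x / z).
  by rewrite (differential_scale H two_neq0 E wR.1 (D' := D)) ?Dx.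
have [p [q pqE]] := regular_coordinates H f_sep Dx wR.
have [P [Q PQE]] := regular_coordinates H' r_sep D'x wR.
(* Compare the two expressions of w: h dx/z, with h = p(x) + q(x) z, equals
   h' dX/Z, with h' = P(X) + Q(X) Z, and dX/Z = - x^(g - 1) dx/z. *)
have [sp q0] : (size p <= g)%N /\ q = 0.
  pose N := maxn (size P) (size Q).
  have sP : (size P <= N.+1)%N by rewrite leqW // leq_maxl.
  have sQ : (size Q <= N.+1)%N by rewrite leqW // leq_maxr.
  have D'x2 : D' x = - (x ^+ 2 * (z / x ^+ g.+1)).
    by rewrite -D'x derV //; field.
  have xV0 : x^-1 != 0 by rewrite invr_eq0.
  have e : ev x ('X^(g.+1) * revp N P + 'X^(N.+2) * p) + ev x (revp N Q +
    'X^(N.+2) * q) * z = 0.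
    move: PQE; rewrite wE pqE D'x2 (eval_x_revp iota xV0 sP) (eval_x_revp iota xV0
      sQ).
    rewrite !rmorphD !(rmorphXn, rmorphM) !eval_xX invrK !exprVn => PQE.
    have -> : ev x (revp N P) = x ^+ N * (x ^- N * ev x (revp N P)).
      by rewrite mulrA divff ?mul1r // expf_neq0.
    have -> : x ^- N * ev x (revp N P) = (ev x p +
      ev x q * z) * (- (x ^+ 2 * (z / x ^+ g.+1)) / z) -
        x ^- N * ev x (revp N Q) * (z / x ^+ g.+1).
      by rewrite PQE addrK.
    rewrite -![N.+2]addn2 !exprD; field.
    by rewrite z0 !expf_neq0 // x0.
  have [e1 e2] := hyp_free H e.
  have Xn0 m : 'X^m != 0 :> {poly k} by rewrite -size_poly_eq0 size_polyXn.
  have sX m (r : {poly k}) : r != 0 -> size ('X^m * r)%R = (m + size r)%N.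
    by move=> r0; rewrite size_monicM ?monicXn // size_polyXn addSn.
  split.
    have [->|p0] := eqVneq p 0; first by rewrite size_poly0.
    have : (size ('X^(N.+2) * p)%R <= g.+1 + N.+1)%N.
      have -> : 'X^(N.+2) * p = - ('X^(g.+1) * revp N P).
        by apply/eqP; rewrite -addr_eq0 addrC e1.
      rewrite size_polyN; have [->|r0] := eqVneq (revp N P) 0.
        by rewrite mulr0 size_poly0.
      by rewrite sX // leq_add2l size_revp.
    by rewrite sX // !addSn addnS !ltnS addnC leq_add2r.
  apply/eqP; apply: contraT => q0.
  have : (size ('X^(N.+2) * q)%R <= N.+1)%N.
    have -> : 'X^(N.+2) * q = - revp N Q by apply/eqP; rewrite -addr_eq0 addrC e2.
    by rewrite size_polyN size_revp.
  by rewrite sX //; lia.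
have sumE (c : 'rV[k]_g) E :
    \sum_i iota (c 0 i) * (ev x 'X^i * E x / z) = ev x (rVpoly c) * (E x / z).
  rewrite (eval_x_sum iota x (n := g)) ?size_poly // mulr_suml;
    apply: eq_bigr => i _.
  by rewrite coef_rVpoly_ord rmorphXn eval_xX; ring.
exists (poly_rV p); split=> [E|c cE].
  by rewrite sumE poly_rV_K // wE pqE q0 rmorph0 mul0r addr0.
have := cE D; rewrite sumE Dx divff // mulr1 pqE q0 rmorph0 mul0r addr0.
move/eqP; rewrite -subr_eq0 -rmorphB (hyp_eval_eq0 H) subr_eq0 => /eqP ->.
by rewrite rVpolyK.
Qed.

End Genus.

(** * The field attached to a prime element *)

Lemma fraction_quotient (R : idomainType) (f : {fraction R}) :
  exists n d : R, d != 0 /\ f = FracField.tofrac n / FracField.tofrac d.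
Proof.
elim/quotW: f => r.
pose n : R := (frac r).1; pose d : R := (frac r).2.
have d0 : d != 0 by rewrite denom_ratioP.
exists n, d; split=> //; have dF0 : FracField.tofrac d != 0 by rewrite tofrac_eq0.
apply: (mulIf dF0); rewrite divfK //.
unlock FracField.tofrac; rewrite -[LHS]FracField.pi_mul.
apply/eqmodP; rewrite /= FracField.equivfE /FracField.mulf.
by rewrite !(numer_Ratio, denom_Ratio) ?mulr1 ?oner_eq0 // mulrC.
Qed.

Section PrimeQuotient.
Variables (A : comNzRingType) (p : A).

(** Stated so that the multiples of p form a prime ideal different from the
    whole ring. *)
Definition prime_element := ~ (exists a, 1 = a * p) /\
  forall a b, (exists c, a * b = c * p) ->
    (exists c, a = c * p) \/ (exists c, b = c * p).

Hypothesis p_prime : prime_element.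

(** The dummy argument lets the canonical ideal structures on this predicate
    depend on the primality of p. *)
Definition multiples (_ : prime_element) : {pred A} :=
  fun a => `[< exists b, a = b * p >].
Local Notation I := (multiples p_prime).

Lemma multiplesP a : reflect (exists b, a = b * p) (a \in I).
Proof. exact: asboolP. Qed.

Fact multiples_idealr : idealr_closed I.
Proof.
split; first by apply/multiplesP; exists 0; rewrite mul0r.
  by apply/multiplesP; case: p_prime.
move=> a _ _ /multiplesP[b ->] /multiplesP[c ->]; apply/multiplesP.
by exists (a * b + c); rewrite mulrDl mulrA.
Qed.

Fact multiples_prime : prime_idealr_closed I.
Proof.
move=> a b /multiplesP /(proj2 p_prime) [|] /multiplesP ->; rewrite ?orbT //.
Qed.

HB.instance Definition _ := isIdealr.Build A I multiples_idealr.
HB.instance Definition _ := isPrimeIdealrClosed.Build A I multiples_prime.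

Definition quotient_ring := {ideal_quot I}.
HB.instance Definition _ := GRing.ComNzRing.on quotient_ring.

Definition quotient_unit : pred quotient_ring :=
  fun a => `[< exists b, b * a = 1 >].
Definition quotient_inv (a : quotient_ring) : quotient_ring :=
  if pselect (exists b, b * a = 1) is left e then sval (cid e) else a.

Fact quotient_mulVr : {in quotient_unit, left_inverse 1 quotient_inv *%R}.
Proof.
move=> a /asboolP ua; rewrite /quotient_inv; case: pselect => // e.
by case: cid.
Qed.

Fact quotient_unitPl a b : b * a = 1 -> quotient_unit a.
Proof. by move=> ba; apply/asboolP; exists b. Qed.

Fact quotient_invr_out : {in [predC quotient_unit], quotient_inv =1 id}.
Proof.
by move=> a /asboolP na; rewrite /quotient_inv; case: pselect => // /na.
Qed.

HB.instance Definition _ := GRing.ComNzRing_hasMulInverse.Build quotient_ring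
  quotient_mulVr quotient_unitPl quotient_invr_out.

HB.instance Definition _ := GRing.ComUnitRing_isIntegral.Build quotient_ring
  (@Quotient.rquot_IdomainAxiom A I).

Definition to_quotient : {rmorphism A -> quotient_ring} := \pi_{ideal_quot I}.
Definition to_quotient_field : {rmorphism A -> {fraction quotient_ring}} :=
  (@FracField.tofrac quotient_ring) \o to_quotient.

(** The field of fractions of A/(p), together with the morphism from A,
    is the function field of p. *)
Lemma quotient_fieldP :
  (forall a, to_quotient_field a = 0 <-> exists b, a = b * p) /\
  (forall f, exists a b, to_quotient_field b != 0 /\
     f = to_quotient_field a / to_quotient_field b).
Proof.
split=> [a|f].
  split=> [/eqP|[b ->]].
    rewrite /to_quotient_field /= tofrac_eq0 /to_quotient.
    rewrite -(rmorph0 (\pi_{ideal_quot I})) -Quotient.idealrBE subr0.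
    by move/multiplesP.
  apply/eqP; rewrite /to_quotient_field /= tofrac_eq0 /to_quotient.
  rewrite -(rmorph0 (\pi_{ideal_quot I})) -Quotient.idealrBE subr0.
  by apply/multiplesP; exists b.
have [n [d [d0 ->]]] := fraction_quotient f.
exists (repr n), (repr d); rewrite /to_quotient_field /= /to_quotient !reprK.
by rewrite tofrac_eq0.
Qed.

End PrimeQuotient.

(** * Irreducible polynomials in two variables *)

Section Gauss.
Variable k : closedFieldType.
Implicit Types (G H K q : {poly {poly k}}).

(** A polynomial in k[y][x] that vanishes identically at y = a is divisible by
    y - a. *)
Lemma map_horner_eq0 a G : map_poly (horner_eval a) G = 0 ->
  exists G1, G = ('X - a%:P)%:P * G1.
Proof.
move=> G0; exists (map_poly (fun c => c %/ ('X - a%:P)) G).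
apply/polyP=> i; rewrite coefCM coef_map_id0 ?div0p // mulrC divpK //.
rewrite dvdp_XsubCl; apply/rootP.
by have := congr1 (fun P : {poly k} => P`_i) G0; rewrite coef_map coef0.
Qed.

(** Gauss's lemma over an algebraically closed field. At a root of c, one of
    the factors G and H vanishes identically, so that the roots of c can be
    cancelled one after the other. *)
Lemma gauss_split (c : {poly k}) q G H : c != 0 -> c%:P * q = G * H ->
  exists u v G' H',
    [/\ u != 0, v != 0, G = u%:P * G', H = v%:P * H' & q = G' * H'].
Proof.
elim/ltn_ind: (size c) {-2}c (erefl (size c)) G H => n IH {}c sc G H c0 e.
have [sc1|sc1] := eqVneq (size c) 1%N.
  have /size_poly1P[b b0 cE] : size c == 1%N by rewrite sc1.
  exists 1, b%:P, G, (b^-1%:P%:P * H).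
  split; rewrite ?oner_eq0 ?polyC_eq0 ?mul1r //.
    by rewrite mulrA -!polyCM divff // mul1r.
  rewrite mulrCA -e cE mulrA -!polyCM mulVf // mul1r //.
have /closed_rootP[a /factor_theorem[c1 cE]] := sc1.
have c10 : c1 != 0 by apply: contraNneq c0 => c10; rewrite cE c10 mul0r.
have sc' : (size c1 < n)%N.
  by rewrite -sc cE size_Mmonic ?monicXsubC // size_XsubC addn2.
have Xa0 : ('X - a%:P)%:P != 0 :> {poly {poly k}} by rewrite polyC_eq0
  polyXsubC_eq0.
have : map_poly (horner_eval a) G * map_poly (horner_eval a) H = 0.
  rewrite -rmorphM -e rmorphM /= map_polyC /= cE /horner_eval hornerM.
  by rewrite !hornerE subrr mulr0 mul0r.
move/eqP; rewrite mulf_eq0 => /orP[] /eqP /map_horner_eq0[G1 GE].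
- have e1 : c1%:P * q = G1 * H.
    by apply: (mulfI Xa0); rewrite mulrA [RHS]mulrA -GE -e cE polyCM; ring.
  have [u [v [G' [H' [u0 v0 uG vH qE]]]]] := IH _ sc' _ erefl _ _ c10 e1.
  exists (('X - a%:P) * u), v, G', H'; split=> //.
    by rewrite mulf_neq0 // polyXsubC_eq0.
  by rewrite GE uG polyCM mulrA.
- have e1 : c1%:P * q = G * G1.
    apply: (mulfI Xa0); rewrite mulrA [RHS]mulrCA -GE -e cE polyCM; ring.
  have [u [v [G' [H' [u0 v0 uG vH qE]]]]] := IH _ sc' _ erefl _ _ c10 e1.
  exists u, (('X - a%:P) * v), G', H'; split=> //.
    by rewrite mulf_neq0 // polyXsubC_eq0.
  by rewrite GE vH polyCM mulrA.
Qed.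

Lemma size_mul_polyC (c : {poly k}) G : c != 0 -> size (c%:P * G) = size G.
Proof. by move=> c0; rewrite size_Cmul. Qed.

Lemma nonunit_size G : (1 < size G)%N -> G \isn't a GRing.unit.
Proof. by rewrite poly_unitE; case: (size G) => [|[|n]]. Qed.

Variable K : {poly {poly k}}.
Hypothesis K_irr : ~ reducible K.
Hypothesis K_size : size K = 3%N.

Lemma irr_K_neq0 : K != 0.
Proof. by rewrite -size_poly_eq0 K_size. Qed.

(** An irreducible quadratic polynomial over k[y] stays irreducible over
    k(y). *)
Lemma irr_no_linear_factor (c : {poly k}) G H : c != 0 -> c%:P * K = G * H ->
  size G <> 2%N.
Proof.
move=> c0 e sG; have [u [v [G' [H' [u0 v0 GE HE KE]]]]] := gauss_split c0 e.
have sG' : size G' = 2%N by rewrite -sG GE size_mul_polyC.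
have H'0 : H' != 0 by apply: contraNneq irr_K_neq0 => H0; rewrite KE H0 mulr0.
have sH' : size H' = 2%N.
  have G'0 : G' != 0 by rewrite -size_poly_eq0 sG'.
  by move: K_size; rewrite KE size_mul // sG' add2n /= => -[].
by apply: K_irr; exists G', H'; rewrite !nonunit_size ?sG' ?sH'.
Qed.

(** Divisibility by K over k(y) implies divisibility over k[y], because K has
    no factor in k[y]. *)
Lemma irr_dvd_exact (c : {poly k}) q s : c != 0 -> c%:P * q = s * K ->
  exists r, q = r * K.
Proof.
move=> c0 e; have [u [v [G' [H' [u0 v0 GE HE qE]]]]] := gauss_split c0 e.
have sH' : size H' = 3%N by rewrite -K_size HE size_mul_polyC.
have [vU|vNU] := boolP (v%:P \is a GRing.unit).
  exists (G' * v%:P^-1); rewrite {1}HE mulrA mulrVK // qE.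
case: K_irr; exists v%:P, H'; split=> //.
by rewrite nonunit_size ?sH'.
Qed.

(** Over k(y), the greatest common divisor of K and q has degree 0, 1 or 2 in
    x. Degree 1 is impossible, and in the other cases K divides the other
    factor or q. *)
Lemma irr_prime : prime_element K.
Proof.
split=> [[a a1]|q r [s qrE]].
  have /negP[] : K \isn't a GRing.unit by rewrite nonunit_size ?K_size.
  by apply/unitrPr; exists a; rewrite mulrC -a1.
have dvd_exact t : Pdiv.Idomain.dvdp K t -> exists u, t = u * K.
  move=> /Pdiv.Idomain.dvdpP[[c u] /= c0 e].
  by apply: (irr_dvd_exact (c := c) (s := u)) => //; rewrite mul_polyC.
have Kqr : Pdiv.Idomain.dvdp K (q * r) by rewrite qrE Pdiv.Idomain.dvdp_mulIr.
set g := gcdp K q.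
have gK : g %| K := dvdp_gcdl K q.
have g0 : g != 0 by rewrite gcdp_eq0 negb_and irr_K_neq0.
have sg : (size g <= 3)%N by rewrite -K_size dvdp_leq // irr_K_neq0.
have [sg1|sg1] := eqVneq (size g) 1%N.
  right; apply: dvd_exact; rewrite -(Gauss_dvdpr r (d := K) (q := q)) //.
  by rewrite coprimep_def -/g sg1.
have [sg3|sg3] := eqVneq (size g) 3%N.
  have gKe : g %= K by rewrite -(dvdp_size_eqp gK) sg3 K_size.
  by left; apply: dvd_exact; rewrite -(eqp_dvdl q gKe) dvdp_gcdr.
have sg2 : size g = 2%N by move: g0 sg sg1 sg3; rewrite -size_poly_eq0; lia.
have /Pdiv.Idomain.dvdpP[[c u] /= c0 e] := gK.
by have := @irr_no_linear_factor c g u c0; rewrite mul_polyC e mulrC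
  => /(_ erefl).
Qed.

Lemma function_field_exists :
  exists (F : fieldType) (phi : {rmorphism {poly {poly k}} -> F}),
    is_function_field K phi.
Proof.
exists _, (to_quotient_field irr_prime); exact: quotient_fieldP.
Qed.

End Gauss.

(** * From a quadratic equation to a double cover *)

Section Criterion.
Variables (k F : fieldType) (iota : {rmorphism k -> F}).
Local Notation ev := (eval_x iota).
Variables (x z : F) (f : {poly k}).
Hypothesis z2 : z ^+ 2 = ev x f.
Hypothesis free : forall p q, ev x p + ev x q * z = 0 -> p = 0 /\ q = 0.

(** The elements (p + q z)/r; that they form a subfield is how the last
    condition of [hyperelliptic] is verified. *)
Definition quadratic_fraction h := exists p q r,
  ev x r != 0 /\ h = (ev x p + ev x q * z) / ev x r.

Lemma quad_eval p q : quadratic_fraction (ev x p + ev x q * z).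
Proof. by exists p, q, 1; rewrite rmorph1 oner_eq0 divr1. Qed.

Lemma quadD g h : quadratic_fraction g -> quadratic_fraction h ->
  quadratic_fraction (g + h).
Proof.
move=> [p [q [r [r0 ->]]]] [p' [q' [r' [r'0 ->]]]].
exists (p * r' + p' * r), (q * r' + q' * r), (r * r').
rewrite !rmorphD !rmorphM mulf_neq0 //; split=> //.
by field; rewrite r0 r'0.
Qed.

Lemma quadM g h : quadratic_fraction g -> quadratic_fraction h ->
  quadratic_fraction (g * h).
Proof.
move=> [p [q [r [r0 ->]]]] [p' [q' [r' [r'0 ->]]]].
exists (p * p' + q * q' * f), (p * q' + q * p'), (r * r').
rewrite !rmorphD !rmorphM mulf_neq0 // -z2; split=> //.
by field; rewrite r0 r'0.
Qed.

Lemma quadV h : quadratic_fraction h -> quadratic_fraction h^-1.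
Proof.
move=> [p [q [r [r0 ->]]]].
have [e|e] := eqVneq (ev x p + ev x q * z) 0.
  by rewrite e mul0r invr0; have := quad_eval 0 0; rewrite !rmorph0 mul0r addr0.
have e' : ev x p - ev x q * z != 0.
  apply: contraNneq e; rewrite -mulNr -rmorphN => /free[-> /eqP].
  by rewrite oppr_eq0 => /eqP ->; rewrite !rmorph0 mul0r addr0.
have nE : ev x (p ^+ 2 - q ^+ 2 * f) = (ev x p +
  ev x q * z) * (ev x p - ev x q * z).
  by rewrite rmorphB !expr2 !rmorphM -z2; ring.
exists (p * r), (- q * r), (p ^+ 2 - q ^+ 2 * f).
rewrite nE !rmorphM rmorphN mulf_neq0 //; split=> //.
by field; rewrite r0 e e'.
Qed.

End Criterion.

Section Presentation.
Variables (k : closedFieldType).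
Hypothesis two_neq0 : (2%:R : k) != 0.
Variables (A B C : {poly k}).
Let K : {poly {poly k}} := A%:P * 'X^2 + B%:P * 'X + C%:P.
Let D : {poly k} := B ^+ 2 - 4%:R * A * C.
Hypothesis K_irr : ~ reducible K.
Hypothesis A_neq0 : A != 0.

Lemma quadratic_size : size K = 3%N.
Proof.
have -> : K = ((A%:P) * 'X + B%:P) * 'X + C%:P by rewrite /K expr2; ring.
rewrite !(size_MXaddC, size_polyC) /= A_neq0.
by rewrite -size_poly_eq0 size_MXaddC polyC_eq0 (negPf A_neq0) size_polyC A_neq0.
Qed.

Lemma four_A_neq0 : 4%:R * A != 0.
Proof.
by rewrite mulf_neq0 // -polyC_natr polyC_eq0 (natrM _ 2 2) mulf_neq0.
Qed.

Lemma two_A_neq0 : 2%:R * A != 0.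
Proof. by rewrite mulf_neq0 // -polyC_natr polyC_eq0. Qed.

Lemma size_linear (U V : {poly k}) : U != 0 ->
  size (U%:P * 'X + V%:P : {poly {poly k}}) = 2.
Proof. by move=> U0; rewrite size_MXaddC polyC_eq0 (negPf U0) size_polyC U0. Qed.

(** If D = S^2, then 4 A K = (2 A x + B - S) (2 A x + B + S). *)
Lemma disc_nonsquare S : D <> S ^+ 2.
Proof.
move=> DE; apply: (irr_no_linear_factor K_irr quadratic_size four_A_neq0
  (G := (2%:R * A)%:P * 'X + (B - S)%:P) (H := (2%:R * A)%:P * 'X + (B + S)%:P)).
  have -> : (4%:R * A)%:P * K = ((2%:R * A)%:P * 'X + B%:P) ^+ 2 - D%:P.
    rewrite /K /D; move: A B C => a b c.
    rewrite !(polyCB, polyCM, polyC_exp, polyC_natr).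
    by ring.
  rewrite DE polyC_exp polyCB polyCD.
  by ring.
by rewrite size_linear // two_A_neq0.
Qed.

Section FunctionField.
Variables (F : fieldType) (phi : {rmorphism {poly {poly k}} -> F}).
Hypothesis phiP : is_function_field K phi.

Let iota : {rmorphism k -> F} := phi \o polyC \o polyC.
Let y := phi 'X%:P.

Lemma phi_polyC p : phi p%:P = eval_x iota y p.
Proof.
elim/poly_ind: p => [|p c IH]; first by rewrite !rmorph0.
by rewrite polyCD polyCM !rmorphD !rmorphM eval_xX eval_xC IH.
Qed.

(** The quadratic equation K = 0 is (2 A x + B)^2 = D. The square root z of D
    and 1 are independent over k[y], because a multiple of K has degree at
    least 2 in x. *)
Lemma hyperelliptic_of_quadratic (L h : {poly k}) : D = h * L ^+ 2 -> L != 0 ->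
  hyperelliptic iota y (phi ((2%:R * A)%:P * 'X + B%:P) / eval_x iota y L) h.
Proof.
move=> DE L0; set x := phi 'X; set z := _ / _.
have [phi0 phi_frac] := phiP.
have phi_small U V : phi (U%:P * 'X + V%:P) = 0 -> U = 0 /\ V = 0.
  move/phi0 => [s e]; have [s0|s0] := eqVneq s 0.
    move: e; rewrite s0 mul0r => e.
    have := congr1 (fun P : {poly {poly k}} => P`_0) e.
    have := congr1 (fun P : {poly {poly k}} => P`_1) e.
    by rewrite !coefD !coefMX !coefC /= !addr0 add0r.
  have : (size (s * K)%R <= 2)%N.
    by rewrite -e size_MXaddC; case: ifP => // _; rewrite ltnS size_polyC leq_b1.
  rewrite size_mul // ?(irr_K_neq0 quadratic_size) // quadratic_size.
  by rewrite addnC /= ltnS ltnS leqn0 size_poly_eq0 (negPf s0).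
have ev_eq0 p : eval_x iota y p = 0 -> p = 0.
  by rewrite -phi_polyC => e; have [] := phi_small 0 p;
    rewrite // rmorphD rmorphM !rmorph0 mul0r add0r.
have L0' : eval_x iota y L != 0 by apply: contraNneq L0 => /ev_eq0 ->.
have A0' : eval_x iota y (2%:R * A) != 0 by apply: contraNneq two_A_neq0 =>
  /ev_eq0 ->.
have zE : z * eval_x iota y L = eval_x iota y (2%:R * A) * x + eval_x iota y B.
  by rewrite /z divfK // rmorphD rmorphM !phi_polyC.
have KE : phi K = 0 by apply/phi0; exists 1; rewrite mul1r.
have z2 : z ^+ 2 = eval_x iota y h.
  apply: (mulIf (expf_neq0 2 L0')); rewrite -exprMn -rmorphXn -rmorphM -DE zE.
  apply/eqP; rewrite -subr_eq0; apply/eqP.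
  transitivity (phi ((4%:R * A)%:P * K)); last by rewrite rmorphM KE mulr0.
  rewrite /K /D -!phi_polyC /x -rmorphM -rmorphD -rmorphXn -rmorphB;
    congr (phi _).
  move: A B C => a b c.
  rewrite !(polyCB, polyCM, polyC_exp, polyC_natr).
  by ring.
have free p q : eval_x iota y p + eval_x iota y q * z = 0 -> p = 0 /\ q = 0.
  move=> e; have [] := phi_small (q * (2%:R * A)) (p * L + q * B).
    rewrite rmorphD rmorphM -/x !phi_polyC rmorphD !rmorphM -!rmorphM.
    have := congr1 (fun u => u * eval_x iota y L) e.
    rewrite mul0r mulrDl -mulrA zE => <-.
    by rewrite !rmorphM; ring.
  move/eqP; rewrite mulf_eq0 (negPf two_A_neq0) orbF => /eqP q0.
  by rewrite q0 mul0r addr0 => /eqP; rewrite mulf_eq0 (negPf L0) orbF => /eqP.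
split=> // g.
have quadphi u : quadratic_fraction iota y z (phi u).
  elim/poly_ind: u => [|u c IH].
    by rewrite rmorph0; have := quad_eval iota y z 0 0;
      rewrite !rmorph0 mul0r addr0.
  rewrite rmorphD rmorphM; apply: quadD; last first.
    by rewrite phi_polyC; have := quad_eval iota y z c 0;
      rewrite rmorph0 mul0r addr0.
  apply: (quadM z2) => //.
  exists (- B), L, (2%:R * A); split=> //.
  by rewrite rmorphN [_ * z]mulrC zE -/x addrC addrK mulrAC divff ?mul1r.
have [q [r [r0 ->]]] := phi_frac g.
by apply: (quadM z2); [|apply: (quadV z2 free)]; apply: quadphi.
Qed.

End FunctionField.
End Presentation.

(** * Multiple roots of binary forms *)

Section Quadratics.
Variable k : fieldType.
Implicit Types p q D : {poly k}.

Lemma quadraticE p : (size p <= 3)%N -> p = (p`_0)%:P + p`_1 *: 'X + p`_2 *: 'X^2.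
Proof.
move=> sp; apply/polyP=> i.
rewrite !coefD !coefZ coefC coefX coefXn.
case: i => [|[|[|i]]] /=; rewrite ?mulr0 ?mulr1 ?addr0 ?add0r //.
by rewrite nth_default ?mulr0 ?addr0 // (leq_trans sp).
Qed.

Lemma coefM_quadratics p q : (size p <= 3)%N -> (size q <= 3)%N ->
  [/\ (p * q)`_0 = p`_0 * q`_0,
      (p * q)`_1 = p`_0 * q`_1 + p`_1 * q`_0,
      (p * q)`_2 = p`_0 * q`_2 + p`_1 * q`_1 + p`_2 * q`_0,
      (p * q)`_3 = p`_1 * q`_2 + p`_2 * q`_1
    & (p * q)`_4 = p`_2 * q`_2].
Proof.
move=> sp sq.
have p3 i : (2 < i)%N -> p`_i = 0 by move=> i3;
  rewrite nth_default // (leq_trans sp).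
have q3 i : (2 < i)%N -> q`_i = 0 by move=> i3;
  rewrite nth_default // (leq_trans sq).
split; rewrite coefM !big_ord_recr big_ord0 /= ?subnn ?subn0 ?add0r //.
- by rewrite (q3 3%N) // (p3 3%N) // mulr0 mul0r add0r addr0.
- by rewrite (q3 4%N) // (q3 3%N) // (p3 4%N) // (p3 3%N) // !mulr0 !mul0r !add0r
  !addr0.
Qed.

Lemma size_mul_quadratics p q : (size p <= 3)%N -> (size q <= 3)%N ->
  (size (p * q)%R <= 5)%N.
Proof.
move=> sp sq; apply: leq_trans (size_polyMleq _ _) _; move: sp sq.
by case: (size p) => [|[|[|[|?]]]] //; case: (size q) => [|[|[|[|?]]]].
Qed.

Lemma revp_mul_quadratics p q : (size p <= 3)%N -> (size q <= 3)%N ->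
  revp 4 (p * q) = revp 2 p * revp 2 q.
Proof.
move=> sp sq; have [e0 e1 e2 e3 e4] := coefM_quadratics sp sq.
have [r0 r1 r2 r3 r4] := coefM_quadratics (size_revp 2 p) (size_revp 2 q).
apply/polyP=> i; case: i => [|[|[|[|[|i]]]]].
- by rewrite r0 !coef_revp /= e4.
- by rewrite r1 !coef_revp /= e3; ring.
- by rewrite r2 !coef_revp /= e2; ring.
- by rewrite r3 !coef_revp /= e1; ring.
- by rewrite r4 !coef_revp /= e0.
rewrite coef_revp /= nth_default //.
by apply: leq_trans (size_mul_quadratics (size_revp 2 p) (size_revp 2 q)) _.
Qed.

Lemma size_sqr_linear (u v : k) : (size ((v *: 'X - u%:P) ^+ 2)%R <= 3)%N.
Proof.
rewrite expr2; apply: leq_trans (size_polyMleq _ _) _.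
have s2 : (size (v *: 'X - u%:P)%R <= 2)%N.
  rewrite (leq_trans (size_polyD _ _)) // geq_max size_polyN size_polyC.
  by rewrite (leq_trans (size_scale_leq _ _)) ?size_polyX //
    (leq_trans (leq_b1 _)).
by move: s2; case: (size _) => [|[|[|?]]].
Qed.

Lemma revp_sqr_linear (u v : k) :
  revp 2 ((v *: 'X - u%:P) ^+ 2) = (v%:P - u *: 'X) ^+ 2.
Proof.
have c (a b : k) : (a *: 'X + b%:P) ^+ 2 = (a ^+ 2) *: 'X^2 +
  (2%:R * a * b) *: 'X + (b ^+ 2)%:P :> {poly k}.
  by rewrite -!mul_polyC !polyCM ?polyC_exp polyC_natr; ring.
have -> : v%:P - u *: 'X = (- u) *: 'X + v%:P by rewrite scaleNr addrC.
rewrite -polyCN !c; apply/polyP=> i; rewrite coef_revp.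
rewrite !coefD !coefZ !coefC !coefX !coefXn.
by case: i => [|[|[|i]]] //=; ring.
Qed.

End Quadratics.

Section Multiplicity.
Variable k : fieldType.
Implicit Types p q D : {poly k}.

(** The form of degree n with dehomogenization D vanishes to order at least m at
    [u : v]; at infinity, v = 0, this is a drop of the degree. *)
Definition mult_ge m n D (u v : k) : bool :=
  if v != 0 then ('X - (u / v)%:P) ^+ m %| D else (size D <= n.+1 - m)%N.

Lemma mult_ge2_factor D (u v : k) : (size D <= 5)%N -> (u, v) != 0 ->
  mult_ge 2 4 D u v ->
  exists2 h : {poly k}, (size h <= 3)%N & D = h * (v *: 'X - u%:P) ^+ 2.
Proof.
move=> sD uv0; rewrite /mult_ge; have [v0|v0] := eqVneq v 0; rewrite /= => H.
  have u0 : u != 0.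
    by apply: contraNneq uv0 => u0; rewrite u0 v0.
  exists (u ^- 2 *: D); first by rewrite (leq_trans (size_scale_leq _ _)).
  rewrite v0 scale0r sub0r sqrrN -polyC_exp mulrC mul_polyC scalerA divff ?scale1r
    //.
  by rewrite expf_neq0.
have /dvdpP[h DE] := H.
have lE : 'X - (u / v)%:P = v^-1 *: (v *: 'X - u%:P).
  by rewrite scalerBr scalerA mulVf // scale1r -mul_polyC -polyCM mulrC.
exists (v ^- 2 *: h); last first.
  by rewrite DE lE exprZn -!mul_polyC exprVn; ring.
rewrite (leq_trans (size_scale_leq _ _)) //.
have [->|h0] := eqVneq h 0; first by rewrite size_poly0.
move: sD; rewrite DE size_Mmonic ?monic_exp ?monicXsubC //.
by rewrite size_exp_XsubC addnC /=; lia.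
Qed.

Lemma mult_ge2_of_factor (h : {poly k}) (u v : k) : (size h <= 3)%N ->
  (u, v) != 0 ->
  mult_ge 2 4 (h * (v *: 'X - u%:P) ^+ 2) u v.
Proof.
move=> sh uv0; rewrite /mult_ge; have [v0|v0] := eqVneq v 0; rewrite /=.
  rewrite v0 scale0r sub0r sqrrN -polyC_exp mulrC mul_polyC.
  by rewrite (leq_trans (size_scale_leq _ _)).
have -> : v *: 'X - u%:P = v *: ('X - (u / v)%:P).
  by rewrite scalerBr -[v *: _%:P]mul_polyC -polyCM mulrCA divff // mulr1.
by rewrite exprZn -scalerAr dvdpZr ?expf_neq0 // dvdp_mull.
Qed.

(** A form of degree 4 with two multiple roots is a multiple of a square. *)
Lemma mult_ge2_unique D (u v u' v' : k) : (forall S c, D <> c *: S ^+ 2) ->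
  (size D <= 5)%N -> (u, v) != 0 -> (u', v') != 0 ->
  mult_ge 2 4 D u v -> mult_ge 2 4 D u' v' -> u * v' = v * u'.
Proof.
move=> D_nsq sD uv0 uv'0.
rewrite /mult_ge; have [v0|v0] := eqVneq v 0;
  have [v'0|v'0] := eqVneq v' 0 => //=.
- by rewrite v0 v'0 mulr0 mul0r.
- move=> sD3 /dvdpP[h DE]; exfalso.
  have sh : (size h <= 1)%N.
    have [->|h0] := eqVneq h 0; first by rewrite size_poly0.
    move: sD3; rewrite DE size_Mmonic ?monic_exp ?monicXsubC //.
    by rewrite size_exp_XsubC addnC /=; lia.
  by apply: (D_nsq ('X - (u' / v')%:P) h`_0);
    rewrite DE {1}(size1_polyC sh) mul_polyC.
- move=> /dvdpP[h DE] sD3; exfalso.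
  have sh : (size h <= 1)%N.
    have [->|h0] := eqVneq h 0; first by rewrite size_poly0.
    move: sD3; rewrite DE size_Mmonic ?monic_exp ?monicXsubC //.
    by rewrite size_exp_XsubC addnC /=; lia.
  by apply: (D_nsq ('X - (u / v)%:P) h`_0); rewrite DE {1}(size1_polyC sh)
    mul_polyC.
set a := u / v; set b := u' / v' => Da Db.
have [ab|ab] := eqVneq a b.
  have uE : u = a * v by rewrite /a divfK.
  have u'E : u' = b * v' by rewrite /b divfK.
  by rewrite uE u'E ab; ring.
exfalso.
have cop : coprimep (('X - a%:P) ^+ 2) (('X - b%:P) ^+ 2).
  rewrite coprimep_expl // coprimep_expr // coprimep_XsubC.
  by rewrite root_XsubC ?(negPf ab) // eq_sym (negPf ab).
have : ('X - a%:P) ^+ 2 * ('X - b%:P) ^+ 2 %| D by rewrite Gauss_dvdp // Da Db.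
move=> /dvdpP[h DE].
have sh : (size h <= 1)%N.
  have [->|h0] := eqVneq h 0; first by rewrite size_poly0.
  move: sD; rewrite DE size_Mmonic ?monicMl ?monic_exp ?monicXsubC //.
  rewrite size_Mmonic ?monic_neq0 ?monic_exp ?monicXsubC // !size_exp_XsubC /=.
  by rewrite addnC /=; lia.
apply: (D_nsq (('X - a%:P) * ('X - b%:P)) h`_0).
by rewrite DE {1}(size1_polyC sh) mul_polyC exprMn.
Qed.

End Multiplicity.

Section Separability.
Variable k : closedFieldType.
Implicit Types p q h D : {poly k}.

(** A common root of p and p' is a multiple root of p. *)
Lemma separable_no_double p : p != 0 ->
  (forall a, ~~ (('X - a%:P) ^+ 2 %| p)) -> separable_poly p.
Proof.
move=> p0 nd; rewrite separable_poly.unlock coprimep_def; apply: contraT.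
move=> /closed_rootP[a]; rewrite root_gcd => /andP[pa p'a].
have /factor_theorem[q pE] := pa.
have /factor_theorem[r qE] : root q a.
  move: p'a; rewrite pE derivM derivB derivX derivC subr0 mulr1 rootE.
  by rewrite hornerD hornerM !hornerE subrr mulr0 add0r.
by case/negP: (nd a); rewrite pE qE -mulrA -expr2 dvdp_mull.
Qed.

Lemma scaled_square p c S : p = c *: S ^+ 2 -> exists T, p = T ^+ 2.
Proof.
by move=> ->; have [e eE] := closed_sqrt c; exists (e *: S); rewrite exprZn eE.
Qed.

Lemma quadratic_no_double p a : (size p <= 3)%N -> ('X - a%:P) ^+ 2 %| p ->
  exists c, p = c *: ('X - a%:P) ^+ 2.
Proof.
move=> sp /dvdpP[h pE]; exists h`_0.
have sh : (size h <= 1)%N.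
  have [->|h0] := eqVneq h 0; first by rewrite size_poly0.
  move: sp; rewrite pE size_Mmonic ?monic_exp ?monicXsubC //.
  by rewrite size_exp_XsubC addn3 /= !ltnS.
by rewrite pE {1}(size1_polyC sh) mul_polyC.
Qed.

Lemma revpZ n c p : revp n (c *: p) = c *: revp n p.
Proof.
by apply/polyP=> i; rewrite coefZ !coef_revp coefZ; case: ifP; rewrite ?mulr0.
Qed.

Lemma revp_sqr_XsubC (a : k) :
  @revp k 2 (('X - a%:P) ^+ 2) = (1 - a *: 'X) ^+ 2.
Proof. by have := revp_sqr_linear a (1 : k); rewrite scale1r polyC1. Qed.

Lemma nonsquare_quadratic_separable h : (size h <= 3)%N ->
  (forall S, h <> S ^+ 2) -> separable_poly h /\ separable_poly (revp 2 h).
Proof.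
move=> sh nsq.
have h0 : h != 0 by apply/eqP=> h0; apply: (nsq 0); rewrite expr0n.
split; [apply: separable_no_double => // a|apply: separable_no_double => [|a]].
- apply/negP => /(quadratic_no_double sh)[c /scaled_square[T hT]].
  exact: nsq hT.
- by apply: contraNneq h0 => /(revp_eq0 sh) ->.
- apply/negP => /(quadratic_no_double (size_revp 2 h))[c hE].
  have := revpK sh; rewrite hE revpZ revp_sqr_XsubC => /esym/scaled_square[T hT].
  exact: nsq hT.
Qed.

(** A form of degree 4 with a multiple root is the product of a square and
    a quadratic form, which has two distinct roots unless the whole form is
    a square. *)
Lemma mult_ge2_separable_factor D (u v : k) : (size D <= 5)%N -> (u, v) != 0 ->
  (forall S, D <> S ^+ 2) -> mult_ge 2 4 D u v ->
  exists L h, [/\ L != 0, D = h * L ^+ 2, (size h <= 3)%N,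
    separable_poly h & separable_poly (revp 2 h)].
Proof.
move=> sD uv0 nsq /(mult_ge2_factor sD uv0)[h sh DE].
have hns S : h <> S ^+ 2.
  by move=> hE; apply: (nsq (S * (v *: 'X - u%:P))); rewrite DE hE exprMn.
have [h_sep r_sep] := nonsquare_quadratic_separable sh hns.
exists (v *: 'X - u%:P), h; split=> //.
by apply/eqP=> l0; apply: (nsq 0); rewrite DE l0 expr0n mulr0.
Qed.

(** Absence of multiple roots, on the whole projective line, expressed in the
    two charts. *)
Lemma no_mult_ge2_separable D : (size D <= 5)%N -> D != 0 ->
  (forall u v, (u, v) != 0 -> ~~ mult_ge 2 4 D u v) ->
  separable_poly D /\ separable_poly (revp 4 D).
Proof.
move=> sD D0 nm; split; [apply: separable_no_double => // a|apply:
  separable_no_double => [|a]].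
- have := nm a 1; rewrite /mult_ge oner_eq0 divr1; apply.
  by rewrite xpair_eqE oner_eq0 andbF.
- by apply: contraNneq D0 => /(revp_eq0 sD) ->.
apply/negP => /dvdpP[h rE].
have [h0|h0] := eqVneq h 0.
  by case/negP: D0; rewrite (revp_eq0 sD) // rE h0 mul0r.
have sh : (size h <= 3)%N.
  have := size_revp 4 D; rewrite rE size_Mmonic ?monic_exp ?monicXsubC //.
  by rewrite size_exp_XsubC addn3 /= !ltnS.
have sX : (size (('X - a%:P) ^+ 2) <= 3)%N by rewrite size_exp_XsubC.
have DE : D = revp 2 h * (a *: 'X - 1%:P) ^+ 2.
  rewrite -(revpK sD) rE revp_mul_quadratics // revp_sqr_XsubC polyC1.
  by rewrite -sqrrN opprB.
have uv0 : (1, a) != 0 :> k * k by rewrite xpair_eqE oner_eq0.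
case/negP: (nm 1 a uv0); rewrite DE; apply: mult_ge2_of_factor uv0.
exact: size_revp.
Qed.

End Separability.

(** * Points of the projective line and forms in two variables *)

Section ProjectivePoints.
Variable k : fieldType.

Lemma hcoord_neq0 (P : P1 k) : (hcoord0 P, hcoord1 P) != 0.
Proof. by rewrite /hcoord0 /hcoord1; case: (repr P) => -[u v]. Qed.

Lemma P1_eq (P Q : P1 k) : hcoord0 P * hcoord1 Q = hcoord1 P * hcoord0 Q -> P = Q.
Proof. by move=> e; rewrite -[P]reprK -[Q]reprK; apply/eqmodP/eqP. Qed.

(** A point given by its coordinates: the coordinates of the representative
    chosen in its class are proportional to them. *)
Lemma P1_point (u v : k) : (u, v) != 0 ->
  exists P : P1 k, exists c, [/\ c != 0, hcoord0 P = c * u & hcoord1 P = c * v].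
Proof.
move=> uv0; have uv0' := uv0; pose w : nonzero_pair k := exist _ (u, v) uv0'.
exists (\pi_(P1 k) w); set P := \pi_(P1 k) w.
have e : hcoord0 P * v = hcoord1 P * u.
  have : repr P = w %[mod P1 k] by rewrite reprK.
  by move/eqmodP => /= /eqP.
have P0 := hcoord_neq0 P.
have [v0|v0] := eqVneq v 0.
  have u0 : u != 0 by apply: contraNneq uv0 => u0; rewrite u0 v0.
  have h1 : hcoord1 P = 0.
    by apply/eqP; move/eqP: e; rewrite v0 mulr0 eq_sym mulf_eq0 (negPf u0) orbF.
  exists (hcoord0 P / u); split.
  - rewrite mulf_neq0 ?invr_eq0 //; apply: contraNneq P0 => h0.
    by rewrite h0 h1.
  - by rewrite divfK.
  - by rewrite h1 v0 mulr0.
have h0E : hcoord0 P = hcoord1 P / v * u by rewrite mulrAC -e mulfK.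
exists (hcoord1 P / v); split=> //; last by rewrite divfK.
rewrite mulf_neq0 ?invr_eq0 //; apply: contraNneq P0 => h1.
by rewrite h0E h1 !mul0r.
Qed.

End ProjectivePoints.

Section Forms.
Variable k : fieldType.
Implicit Types p q D : {poly k}.

Definition homogenize n p : {mpoly k[2]} :=
  \sum_(i < n.+1) p`_i *: ('X_0 ^+ i * 'X_1 ^+ (n - i)).

Local Notation chart a b := (mmap (@polyC k) (tnth [tuple a; b])).

Lemma chartX0 (a b : {poly k}) : chart a b 'X_0 = a.
Proof. by rewrite mmapX mmap1U (tnth_nth 0). Qed.

Lemma chartX1 (a b : {poly k}) : chart a b 'X_1 = b.
Proof. by rewrite mmapX mmap1U (tnth_nth 0). Qed.

Lemma chartZ (a b : {poly k}) c f : chart a b (c *: f) = c *: chart a b f.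
Proof. by rewrite mmapZ mul_polyC. Qed.

Lemma chart_homogenize (a b : {poly k}) n p : chart a b (homogenize n p) =
  \sum_(i < n.+1) p`_i *: (a ^+ i * b ^+ (n - i)).
Proof.
rewrite /homogenize rmorph_sum /=; apply: eq_bigr => i _.
by rewrite chartZ rmorphM !rmorphXn /= chartX0 chartX1.
Qed.

Lemma chart_affine n p : (size p <= n.+1)%N -> chart 'X 1 (homogenize n p) = p.
Proof.
move=> sp; rewrite chart_homogenize -[RHS](coefK p) poly_def.
rewrite (big_ord_widen n.+1 (fun i => p`_i *: 'X^i)) // [RHS]big_mkcond /=.
apply: eq_bigr => i _; rewrite expr1n mulr1; case: ltnP => // sp'.
by rewrite nth_default // scale0r.
Qed.

Lemma chart_infinity n p : chart 1 'X (homogenize n p) = revp n p.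
Proof.
rewrite chart_homogenize /revp poly_def (reindex_inj rev_ord_inj) /=.
apply: eq_bigr => i _; rewrite expr1n mul1r subSS; congr (_ *: 'X^_).
by rewrite subKn // -ltnS.
Qed.

Lemma homogenize_mul_quadratics p q : (size p <= 3)%N -> (size q <= 3)%N ->
  homogenize 4 (p * q) = homogenize 2 p * homogenize 2 q.
Proof.
move=> sp sq; have [e0 e1 e2 e3 e4] := coefM_quadratics sp sq.
rewrite /homogenize !big_ord_recr !big_ord0 /= e0 e1 e2 e3 e4.
rewrite -!mul_mpolyC !mpolyCD !mpolyCM.
move: 'X_0 'X_1 => X0 X1; rewrite !subnn !subn0.
move: (p`_0)%:MP (p`_1)%:MP (p`_2)%:MP (q`_0)%:MP (q`_1)%:MP (q`_2)%:MP.
move=> p0 p1 p2 q0 q1 q2; rewrite -[(2 - 1)%N]/1%N -[(4 - 1)%N]/3%N -[(4 -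
  2)%N]/2%N -[(4 - 3)%N]/1%N.
by ring.
Qed.

Lemma homogenizeB n p q : homogenize n (p - q) = homogenize n p - homogenize n q.
Proof.
rewrite /homogenize -sumrB; apply: eq_bigr => i _.
by rewrite coefB scalerBl.
Qed.

Lemma homogenizeZ n c p : homogenize n (c *: p) = c *: homogenize n p.
Proof.
rewrite /homogenize scaler_sumr; apply: eq_bigr => i _.
by rewrite coefZ scalerA.
Qed.

Lemma homogenize_sqr_linear (P : P1 k) :
  homogenize 2 ((hcoord1 P *: 'X - (hcoord0 P)%:P) ^+ 2) = linear_form P ^+ 2.
Proof.
rewrite /linear_form; move: (hcoord0 P) (hcoord1 P) => u v.
have -> : (v *: 'X - u%:P) ^+ 2 = (v ^+ 2) *: 'X^2 + (- 2%:R * u * v) *: 'X +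
  (u ^+ 2)%:P :> {poly k}.
  by rewrite -!mul_polyC !polyCM ?polyC_exp polyCN polyC_natr; ring.
rewrite /homogenize !big_ord_recr !big_ord0 /=.
rewrite !coefD !coefZ !coefC !coefX !coefXn /=.
rewrite -!mul_mpolyC !mpolyCD !mpolyCM !mpolyCN.
have -> : (2%:R : k)%:MP_[2] = 2%:R by rewrite rmorph_nat.
rewrite mpolyC0 mpolyC1 subnn subn0 -[(2 - 1)%N]/1%N.
move: 'X_0 'X_1 u%:MP_[2] v%:MP_[2] => X0 X1 a b.
by ring.
Qed.

(** Dehomogenize in the chart that contains the point. *)
Lemma form_mult_ge m n D (P : P1 k) : (size D <= n.+1)%N ->
  (exists g, homogenize n D = g * linear_form P ^+ m) ->
  mult_ge m n D (hcoord0 P) (hcoord1 P).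
Proof.
move=> sD [g gE]; have := hcoord_neq0 P.
move: gE; rewrite /linear_form; move: (hcoord0 P) (hcoord1 P) => u v gE uv0.
rewrite /mult_ge; have [v0|v0] := eqVneq v 0; rewrite /=.
  have u0 : u != 0 by apply: contraNneq uv0 => u0; rewrite u0 v0.
  have := congr1 (chart 1 'X) gE; rewrite chart_infinity rmorphM rmorphXn rmorphB
    /= !chartZ.
  rewrite chartX0 chartX1 v0 scale0r sub0r -scaleNr exprZn => rE.
  apply/leq_sizeP => i le_i; have [le_in|lt_ni] := leqP i n; last first.
    by rewrite nth_default // (leq_trans sD).
  have := coef_revp n D (n - i); rewrite leq_subr subKn // => <-.
  rewrite rE -scalerAr coefZ coefMXn.
  have -> : (n - i < m)%N by lia.
  by rewrite mulr0.
have := congr1 (chart 'X 1) gE; rewrite chart_affine // rmorphM rmorphXn rmorphB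
  /= !chartZ.
rewrite chartX0 chartX1 => ->.
have -> : v *: 'X - u *: 1 = v *: ('X - (u / v)%:P).
  rewrite scalerBr -[v *: _%:P]mul_polyC -polyCM mulrCA divff // mulr1.
  by rewrite alg_polyC.
by rewrite exprZn -scalerAr dvdpZr ?expf_neq0 // dvdp_mull.
Qed.

Lemma mult_ge2_form D (P : P1 k) : (size D <= 5)%N ->
  mult_ge 2 4 D (hcoord0 P) (hcoord1 P) ->
  exists g, homogenize 4 D = g * linear_form P ^+ 2.
Proof.
move=> sD /(mult_ge2_factor sD (hcoord_neq0 P))[h sh ->].
exists (homogenize 2 h).
by rewrite homogenize_mul_quadratics ?size_sqr_linear // homogenize_sqr_linear.
Qed.

Lemma double_root_mult_ge D (P : P1 k) : (size D <= 5)%N ->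
  ~~ mult_ge 3 4 D (hcoord0 P) (hcoord1 P) ->
  double_root (homogenize 4 D) P <-> mult_ge 2 4 D (hcoord0 P) (hcoord1 P).
Proof.
move=> sD n3; split=> [[g _]|m2]; first exact: form_mult_ge.
split; first exact: mult_ge2_form.
by move/(form_mult_ge sD); apply/negP.
Qed.

End Forms.

(** * The kernel and its partial derivatives *)

Section Kernel.
Variables (k : fieldType) (d : 'I_3 -> 'I_3 -> k) (t : k).

Definition kcoef (i j : 'I_3) : k :=
  ((i == 1 :> nat) && (j == 1 :> nat))%:R - t * d i j.

Definition kpoly (i : 'I_3) : {poly k} :=
  (kcoef i 0)%:P + kcoef i 1 *: 'X + kcoef i 2 *: 'X^2.

Definition kdisc : {poly k} := kpoly 1 ^+ 2 - 4%:R * kpoly 2 * kpoly 0.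

Lemma kpoly_coef i :
  [/\ (kpoly i)`_0 = kcoef i 0, (kpoly i)`_1 = kcoef i 1
    & (kpoly i)`_2 = kcoef i 2].
Proof.
by split; rewrite !coefD !coefZ coefC coefX coefXn /= ?mulr0 ?mulr1 ?addr0 ?add0r.
Qed.

Lemma size_kpoly i : (size (kpoly i) <= 3)%N.
Proof.
apply/leq_sizeP => -[|[|[|j]]] // _.
by rewrite !coefD !coefZ coefC coefX coefXn /= !mulr0 !addr0.
Qed.

Lemma size_kdisc : (size kdisc <= 5)%N.
Proof.
rewrite /kdisc (leq_trans (size_polyD _ _)) // geq_max size_polyN expr2.
rewrite size_mul_quadratics ?size_kpoly // -mulrA mulr_natl.
by rewrite -scaler_nat (leq_trans (size_scale_leq _ _)) // size_mul_quadratics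
  ?size_kpoly.
Qed.

Lemma kernelE : kernel d t =
  (kpoly 2)%:P * 'X^2 + (kpoly 1)%:P * 'X + (kpoly 0)%:P.
Proof.
rewrite /kernel !sum3 !ord0E !ord1E !ord2E /kpoly /kcoef /=.
rewrite -!mul_polyC !(polyCD, polyCB, polyCM, polyCN) ?polyC_exp ?polyC0 ?polyC1.
move: 'X%:P 'X => Y X.
by ring.
Qed.

Lemma coef2E i : coef2 d t i = homogenize 2 (kpoly i).
Proof.
have [e0 e1 e2] := kpoly_coef i.
rewrite /coef2 sum3 /homogenize !big_ord_recr big_ord0 /= e0 e1 e2 /kcoef.
rewrite !ord0E !ord1E !ord2E !andbF !andbT -!mul_mpolyC.
rewrite !(mpolyCD, mpolyCB, mpolyCM, mpolyCN) mpolyC0 rmorph_nat.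
rewrite subnn subn0 -[(2 - 1)%N]/1%N.
move: 'X_0 'X_1 t%:MP_[2] => X0 X1 c.
by ring.
Qed.

Lemma Delta2E : Delta2 d t = homogenize 4 kdisc.
Proof.
have e4 : homogenize 4 (4%:R * kpoly 2 * kpoly 0) =
    4%:R * homogenize 2 (kpoly 2) * homogenize 2 (kpoly 0).
  rewrite -2!mulrA 2!mulr_natl -2!scaler_nat homogenizeZ.
  by rewrite homogenize_mul_quadratics ?size_kpoly.
rewrite /Delta2 /B2 /A2 /C2 !coef2E /kdisc homogenizeB e4 !expr2.
by rewrite homogenize_mul_quadratics ?size_kpoly.
Qed.

End Kernel.

Section Evaluation.
Variables (k : fieldType) (d : 'I_3 -> 'I_3 -> k) (t : k).
Local Notation c := (kcoef d t).

Definition qform (a0 a1 a2 u v : k) := a2 * u ^+ 2 + a1 * u * v + a0 * v ^+ 2.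

Lemma mderivXU (n : nat) (R : comNzRingType) (i j : 'I_n) :
  ('X_j : {mpoly R[n]})^`M(i) = (j == i)%:R.
Proof.
rewrite mderivX mnm1E; case: eqVneq => [->|_]; last by rewrite scale0r.
have -> : (U_(i) - U_(i) = 0)%MM by apply/mnmP => l; rewrite mnmBE mnm0E subnn.
by rewrite mpolyX0 scale1r.
Qed.

Lemma meval_qform n (s : 'I_n -> k) (f0 f1 f2 X Y : {mpoly k[n]}) :
  (f2 * X ^+ 2 + f1 * X * Y + f0 * Y ^+ 2).@[s] =
  qform f0.@[s] f1.@[s] f2.@[s] X.@[s] Y.@[s].
Proof. by rewrite !expr2 !(mevalD, mevalM) /qform !expr2. Qed.

(** The chain rule for a quadratic form with variable coefficients; it
    serves both for the outer form in (x0, x1) and for its coefficients. *)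
Lemma mderiv_qform n (s : 'I_n -> k) (i : 'I_n) (f0 f1 f2 X Y : {mpoly k[n]}) :
  (f2 * X ^+ 2 + f1 * X * Y + f0 * Y ^+ 2)^`M(i).@[s] =
  qform f0^`M(i).@[s] f1^`M(i).@[s] f2^`M(i).@[s] X.@[s] Y.@[s] +
  (2%:R * f2.@[s] * X.@[s] + f1.@[s] * Y.@[s]) * X^`M(i).@[s] +
  (f1.@[s] * X.@[s] + 2%:R * f0.@[s] * Y.@[s]) * Y^`M(i).@[s].
Proof.
rewrite !expr2 !(mderivD, mderivM) !(mevalD, mevalM) /qform.
by ring.
Qed.

Definition kernel_row (i : 'I_3) : {mpoly k[4]} :=
  (c i 2)%:MP * 'X_2 ^+ 2 + (c i 1)%:MP * 'X_2 * 'X_3 + (c i 0)%:MP * 'X_3 ^+ 2.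

Lemma kernel_homE : kernel_hom d t =
  kernel_row 2 * 'X_0 ^+ 2 + kernel_row 1 * 'X_0 * 'X_1 +
    kernel_row 0 * 'X_1 ^+ 2.
Proof.
rewrite /kernel_row /kernel_hom !sum3 /kcoef -!mul_mpolyC !ord0E !ord1E !ord2E /=.
rewrite !(mpolyCD, mpolyCB, mpolyCM, mpolyCN) mpolyC0 mpolyC1.
rewrite subnn subn0 -[(2 - 1)%N]/1%N.
move: 'X_0 'X_1 'X_2 'X_3 t%:MP => X0 X1 X2 X3 s.
by ring.
Qed.

Section Point.
Variable P : P1 k * P1 k.
Local Notation x0 := (hcoord0 P.1).
Local Notation x1 := (hcoord1 P.1).
Local Notation y0 := (hcoord0 P.2).
Local Notation y1 := (hcoord1 P.2).
Local Notation row i := (qform (c i 0) (c i 1) (c i 2) y0 y1).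
Local Notation col j := (qform (c 0 j) (c 1 j) (c 2 j) x0 x1).

Let s := tnth [tuple hcoord0 P.1; hcoord1 P.1; hcoord0 P.2; hcoord1 P.2].

Let row_eval i : (kernel_row i).@[s] = row i.
Proof. by rewrite meval_qform !mevalC !mevalXU. Qed.

Let row_deriv (i : 'I_3) (v : 'I_4) : (kernel_row i)^`M(v).@[s] =
  (2%:R * c i 2 * y0 + c i 1 * y1) * (v == 2%R)%:R +
  (c i 1 * y0 + 2%:R * c i 0 * y1) * (v == 3%R)%:R.
Proof.
rewrite mderiv_qform !mderivC !mderivXU !mevalC !mevalXU ?meval0 !rmorph_nat.
by rewrite /qform !mul0r !addr0 add0r ![_ == v]eq_sym.
Qed.

Lemma eval4_kernel : eval4 (kernel_hom d t) P =
  qform (row 0) (row 1) (row 2) x0 x1.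
Proof. by rewrite kernel_homE /eval4 meval_qform !row_eval !mevalXU. Qed.

Lemma eval4_deriv (v : 'I_4) : eval4 (kernel_hom d t)^`M(v) P =
  match val v with
  | 0%N => 2%:R * row 2 * x0 + row 1 * x1
  | 1%N => row 1 * x0 + 2%:R * row 0 * x1
  | 2%N => 2%:R * col 2 * y0 + col 1 * y1
  | _ => col 1 * y0 + 2%:R * col 0 * y1
  end.
Proof.
rewrite kernel_homE /eval4 mderiv_qform -/s !row_eval !row_deriv.
rewrite !mderivXU !mevalXU !rmorph_nat -[s 0]/x0 -[s 1]/x1 /qform.
by case: v => -[|[|[|[|//]]]] ?; rewrite -!val_eqE /=; ring.
Qed.

(** By Euler's identity the four partial derivatives imply that the point
    lies on the curve. *)
Lemma singularityP : (2%:R : k) != 0 -> singularity d t P <->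
  [/\ 2%:R * row 2 * x0 + row 1 * x1 = 0, row 1 * x0 + 2%:R * row 0 * x1 = 0,
      2%:R * col 2 * y0 + col 1 * y1 = 0 & col 1 * y0 + 2%:R * col 0 * y1 = 0].
Proof.
move=> two0; split=> [[_ sing]|[d0 d1 d2 d3]].
  by split; [have := sing 0|have := sing 1|have := sing 2|have := sing 3];
     rewrite eval4_deriv.
split=> [|v]; last by rewrite eval4_deriv; case: v => -[|[|[|[|//]]]].
rewrite /on_curve eval4_kernel; apply: (mulfI two0); rewrite mulr0.
have -> : 2%:R * qform (row 0) (row 1) (row 2) x0 x1 =
  x0 * (2%:R * row 2 * x0 + row 1 * x1) + x1 * (row 1 * x0 + 2%:R * row 0 * x1).
  by rewrite /qform; ring.
by rewrite d0 d1 !mulr0 addr0.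
Qed.

Lemma coef2_eval i : (coef2 d t i).@[tnth [tuple y0; y1]] = row i.
Proof.
have [e0 e1 e2] := kpoly_coef d t i.
rewrite coef2E /homogenize !big_ord_recr big_ord0 /= e0 e1 e2.
rewrite !(mevalD, mevalZ, mevalM) meval0 !rmorphXn /= !mevalXU.
rewrite -[tnth _ 0]/y0 -[tnth _ 1]/y1 /qform.
by rewrite ?subnn ?subn0; ring.
Qed.

Lemma Delta2_eval : is_root (Delta2 d t) P.2 <->
  row 1 ^+ 2 = 4%:R * row 2 * row 0.
Proof.
rewrite /is_root /Delta2 /B2 /A2 /C2 mevalB rmorphXn !mevalM /= !coef2_eval.
rewrite rmorph_nat.
by split=> [/eqP|->]; rewrite ?subrr // subr_eq0 => /eqP.
Qed.

End Point.
End Evaluation.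

(** * Singular points and multiple roots of the discriminant *)

Section QuadraticForms.
Variable k : fieldType.
Implicit Types e f x : k.

(** Where a quadratic form vanishes together with its discriminant, its
    gradient vanishes. *)
Lemma qform_double_root e0 e1 e2 u v : qform e0 e1 e2 u v = 0 ->
  e1 ^+ 2 = 4%:R * e2 * e0 ->
  2%:R * e2 * u + e1 * v = 0 /\ e1 * u + 2%:R * e0 * v = 0.
Proof.
rewrite /qform => q0 disc; split; apply/eqP; rewrite -sqrf_eq0; apply/eqP.
  have -> : (2%:R * e2 * u + e1 * v) ^+ 2 =
    4%:R * e2 * (e2 * u ^+ 2 + e1 * u * v + e0 * v ^+ 2) +
      (e1 ^+ 2 - 4%:R * e2 * e0) * v ^+ 2 by ring.
  by rewrite q0 disc subrr mulr0 mul0r addr0.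
have -> : (e1 * u + 2%:R * e0 * v) ^+ 2 =
  4%:R * e0 * (e2 * u ^+ 2 + e1 * u * v + e0 * v ^+ 2) +
    (e1 ^+ 2 - 4%:R * e2 * e0) * u ^+ 2 by ring.
by rewrite q0 disc subrr mulr0 mul0r addr0.
Qed.

(** Here e2 u^2 + e1 u v + e0 v^2 is a quadratic form that depends on a
    parameter, and f0, f1, f2 are the derivatives of its coefficients. A
    singular point forces the discriminant and its derivative to vanish. *)
Lemma singular_disc_jet e0 e1 e2 f0 f1 f2 x0 x1 : (x0, x1) != 0 ->
  2%:R * e2 * x0 + e1 * x1 = 0 -> e1 * x0 + 2%:R * e0 * x1 = 0 ->
  qform f0 f1 f2 x0 x1 = 0 ->
  e1 ^+ 2 = 4%:R * e2 * e0 /\ 2%:R * e1 * f1 = 4%:R * (f2 * e0 + e2 * f0).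
Proof.
rewrite /qform => x_neq0 h0 h1 hf.
have hA : e1 * x1 = - (2%:R * e2 * x0) by apply/eqP; rewrite -addr_eq0 addrC h0.
have hB : e1 * x0 = - (2%:R * e0 * x1) by apply/eqP; rewrite -addr_eq0 h1.
have [x10|x10] := eqVneq x1 0.
  have x00 : x0 != 0 by apply: contraNneq x_neq0 => x00; rewrite x00 x10.
  have e10 : e1 = 0.
    by apply/eqP; move/eqP: hB; rewrite x10 mulr0 oppr0 mulf_eq0 (negPf x00) orbF.
  have e20 : 2%:R * e2 = 0.
    by apply/eqP; move/eqP: h0; rewrite x10 mulr0 addr0 mulf_eq0 (negPf x00) orbF.
  have f20 : f2 = 0.
    apply/eqP; move/eqP: hf; rewrite x10 expr0n !mulr0 !addr0 mulf_eq0.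
    by rewrite sqrf_eq0 (negPf x00) orbF.
  have e2E y : 4%:R * e2 * y = 2%:R * (2%:R * e2) * y by ring.
  rewrite e10 f20; split; first by rewrite e2E e20; ring.
  by rewrite mul0r add0r [RHS]mulrA e2E e20; ring.
have x12 : x1 ^+ 2 != 0 by rewrite expf_neq0.
split; apply: (mulfI x12).
  have -> : x1 ^+ 2 * e1 ^+ 2 = (e1 * x1) ^+ 2 by ring.
  have -> : x1 ^+ 2 * (4%:R * e2 * e0) =
    2%:R * e2 * x1 * (2%:R * e0 * x1) by ring.
  have -> : 2%:R * e0 * x1 = - (e1 * x0) by rewrite hB opprK.
  have -> : 2%:R * e2 * x1 * - (e1 * x0) = - (2%:R * e2 * x0) * (e1 * x1) by ring.
  by rewrite hA; ring.
have -> : x1 ^+ 2 * (2%:R * e1 * f1) = 2%:R * f1 * x1 * (e1 * x1) by ring.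
have -> : x1 ^+ 2 * (4%:R * (f2 * e0 + e2 * f0)) =
  2%:R * f2 * x1 * (2%:R * e0 * x1) + 4%:R * e2 * f0 * x1 ^+ 2 by ring.
have -> : 2%:R * e0 * x1 = - (e1 * x0) by rewrite hB opprK.
have -> : 2%:R * f2 * x1 * - (e1 * x0) = - (2%:R * f2 * x0 * (e1 * x1)) by ring.
rewrite hA; apply/eqP; rewrite -subr_eq0.
have -> : 2%:R * f1 * x1 * - (2%:R * e2 * x0) - (- (2%:R * f2 * x0 * -
  (2%:R * e2 * x0)) + 4%:R * e2 * f0 * x1 ^+ 2)
  = - 4%:R * e2 * (f2 * x0 ^+ 2 + f1 * x0 * x1 + f0 * x1 ^+ 2) by ring.
by rewrite hf mulr0.
Qed.

(** Conversely, if the discriminant vanishes to second order and the form is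
    not zero, then its double root [- e1 : 2 e2] (or [2 e0 : - e1]) is a
    singular point. *)
Lemma disc_jet_singular e0 e1 e2 f0 f1 f2 : (2%:R : k) != 0 ->
  [|| e0 != 0, e1 != 0 | e2 != 0] ->
  e1 ^+ 2 = 4%:R * e2 * e0 -> 2%:R * e1 * f1 = 4%:R * (f2 * e0 + e2 * f0) ->
  exists x0 x1, [/\ (x0, x1) != 0, 2%:R * e2 * x0 + e1 * x1 = 0,
    e1 * x0 + 2%:R * e0 * x1 = 0 & qform f0 f1 f2 x0 x1 = 0].
Proof.
rewrite /qform => two0 e_neq0 disc hf.
have [e20|e20] := eqVneq e2 0.
  have e10 : e1 = 0 by apply/eqP; rewrite -sqrf_eq0 disc e20 mulr0 mul0r.
  have e00 : e0 != 0 by move: e_neq0; rewrite e10 e20 eqxx !orbF.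
  have f20 : f2 = 0.
    have : 4%:R * (f2 * e0 + e2 * f0) = 0 by rewrite -hf e10 mulr0 mul0r.
    move/eqP; rewrite e20 mul0r addr0 (natrM _ 2 2) !mulf_eq0 (negPf two0) (negPf
      e00) /=.
    by rewrite orbF => /eqP.
  exists 1, 0; rewrite xpair_eqE oner_eq0 e10 e20 f20; split=> //; by ring.
exists (- e1), (2%:R * e2); split.
- by rewrite xpair_eqE mulf_eq0 (negPf two0) (negPf e20) andbF.
- by ring.
- by apply/eqP; rewrite mulrN -expr2 disc addrC subr_eq0; apply/eqP; ring.
have -> : f2 * (- e1) ^+ 2 + f1 * - e1 * (2%:R * e2) + f0 * (2%:R * e2) ^+ 2 =
  f2 * e1 ^+ 2 - e2 * (2%:R * e1 * f1) + 4%:R * f0 * e2 ^+ 2 by ring.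
by rewrite disc hf; ring.
Qed.

End QuadraticForms.

Section Geometry.
Variables (k : fieldType).
Hypothesis two_neq0 : (2%:R : k) != 0.
Variables (d : 'I_3 -> 'I_3 -> k) (t : k).
Local Notation c := (kcoef d t).
Local Notation kp := (kpoly d t).
Local Notation D := (kdisc d t).

(** The value at [u : v] of the quadratic form with dehomogenization p, in the
    affine chart chosen around this point. *)
Definition jet0 (u v : k) (p : {poly k}) : k :=
  if v != 0 then p.[u / v] else p`_2.
Definition jet1 (u v : k) (p : {poly k}) : k :=
  if v != 0 then p^`().[u / v] else p`_1.

(** D vanishes to second order at a point if its value and its first
    derivative vanish there. *)
Lemma mult_ge2_jet u v : mult_ge 2 4 D u v <->
  jet0 u v (kp 1) ^+ 2 = 4%:R * jet0 u v (kp 2) * jet0 u v (kp 0) /\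
  2%:R * jet0 u v (kp 1) * jet1 u v (kp 1) =
    4%:R * (jet1 u v (kp 2) * jet0 u v (kp 0) +
      jet0 u v (kp 2) * jet1 u v (kp 0)).
Proof.
rewrite /mult_ge /jet0 /jet1; have [v0|v0] := eqVneq v 0; rewrite /=.
  have s := size_kpoly d t.
  have [_ _ _ a3 a4] := coefM_quadratics (s 1) (s 1).
  have [_ _ _ b3 b4] := coefM_quadratics (s 2) (s 0).
  have D4 : D`_4 = (kp 1)`_2 ^+ 2 - 4%:R * (kp 2)`_2 * (kp 0)`_2.
    by rewrite /kdisc expr2 coefB -mulrA mulr_natl coefMn a4 b4 -mulr_natl; ring.
  have D3 : D`_3 = 2%:R * (kp 1)`_2 * (kp 1)`_1 - 4%:R * ((kp 2)`_1 * (kp 0)`_2 +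
    (kp 2)`_2 * (kp 0)`_1).
    by rewrite /kdisc expr2 coefB -mulrA mulr_natl coefMn a3 b3 -mulr_natl; ring.
  split=> [sD|[h0 h1]].
    have Di i : (2 < i)%N -> D`_i = 0 by move=> i2;
      rewrite nth_default // (leq_trans sD).
    by split; apply/eqP; rewrite -subr_eq0 -?D4 -?D3 Di.
  apply/leq_sizeP => -[|[|[|[|[|i]]]]] // _.
  - by rewrite D3 h1 subrr.
  - by rewrite D4 h0 subrr.
  - by rewrite nth_default // (leq_trans (size_kdisc d t)).
set a := u / v.
have Da : D.[a] = (kp 1).[a] ^+ 2 - 4%:R * (kp 2).[a] * (kp 0).[a].
  by rewrite /kdisc -polyC_natr !hornerE; ring.
have D'a : D^`().[a] = 2%:R * (kp 1).[a] * (kp 1)^`().[a] -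
    4%:R * ((kp 2)^`().[a] * (kp 0).[a] + (kp 2).[a] * (kp 0)^`().[a]).
  rewrite /kdisc expr2 -polyC_natr !(derivB, derivM, derivC) mul0r add0r.
  by rewrite !(hornerD, hornerM, hornerN, hornerC); ring.
split=> [/dvdpP[h DE]|[h0 h1]].
  split; apply/eqP; rewrite -subr_eq0 -?Da -?D'a DE; apply/eqP.
    by rewrite hornerM horner_exp hornerXsubC subrr expr0n mulr0.
  rewrite expr2 !(derivM, derivB, derivX, derivC).
  by rewrite !(hornerD, hornerM, hornerN, hornerX, hornerC) subrr; ring.
have /factor_theorem[h DE] : root D a by rewrite rootE Da h0 subrr.
have /factor_theorem[h' hE] : root h a.
  have : D^`().[a] = 0 by rewrite D'a h1 subrr.
  rewrite DE derivM derivB derivX derivC subr0 mulr1 rootE => /eqP.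
  by rewrite hornerD hornerM !hornerE subrr mulr0 add0r.
by rewrite DE hE -mulrA -expr2 dvdp_mull.
Qed.

Section Point.
Variable P : P1 k * P1 k.
Local Notation x0 := (hcoord0 P.1).
Local Notation x1 := (hcoord1 P.1).
Local Notation y0 := (hcoord0 P.2).
Local Notation y1 := (hcoord1 P.2).
Local Notation e i := (jet0 y0 y1 (kp i)).
Local Notation f i := (jet1 y0 y1 (kp i)).

Lemma kpoly_horner i a : (kp i).[a] = c i 0 + c i 1 * a + c i 2 * a ^+ 2.
Proof. by rewrite /kpoly !hornerE. Qed.

Lemma kpoly_deriv i a : (kp i)^`().[a] = c i 1 + 2%:R * c i 2 * a.
Proof.
rewrite /kpoly !(derivD, derivC, derivZ, derivX, derivXn) /= add0r.
by rewrite !(hornerD, hornerZ, hornerMn, hornerX, hornerC) -mulr_natl; ring.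
Qed.

(** The two derivatives along the second factor are, by Euler's identity,
    equivalent to a single one in the chart around the point. *)
Lemma singularity_jet : singularity d t P <->
  [/\ 2%:R * e 2 * x0 + e 1 * x1 = 0, e 1 * x0 + 2%:R * e 0 * x1 = 0 &
      qform (f 0) (f 1) (f 2) x0 x1 = 0].
Proof.
apply: (iff_trans (singularityP _ _ _ two_neq0)).
have := hcoord_neq0 P.2; move: y0 y1 x0 x1 => v0 v1 u0 u1; rewrite /jet0 /jet1.
have [v10|v10] := eqVneq v1 0 => /= v_neq0.
  have v00 : v0 != 0 by apply: contraNneq v_neq0 => v00; rewrite v00 v10.
  have rowE i : qform (c i 0) (c i 1) (c i 2) v0 v1 = v0 ^+ 2 * (kp i)`_2.
    by have [_ _ ->] := kpoly_coef d t i; rewrite v10 /qform; ring.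
  have colE : qform (c 0 1) (c 1 1) (c 2 1) u0 u1 =
    qform (kp 0)`_1 (kp 1)`_1 (kp 2)`_1 u0 u1.
    by have [_ -> _] := kpoly_coef d t 0; have [_ -> _] := kpoly_coef d t 1;
       have [_ -> _] := kpoly_coef d t 2.
  have colE2 : qform (c 0 2) (c 1 2) (c 2 2) u0 u1 =
    qform (kp 0)`_2 (kp 1)`_2 (kp 2)`_2 u0 u1.
    by have [_ _ ->] := kpoly_coef d t 0; have [_ _ ->] := kpoly_coef d t 1;
       have [_ _ ->] := kpoly_coef d t 2.
  rewrite !rowE colE colE2 v10; move: (kp 0)`_1 (kp 1)`_1 (kp 2)`_1 => f0 f1 f2.
  move: (kp 0)`_2 (kp 1)`_2 (kp 2)`_2 => e0 e1 e2.
  have v02 : v0 ^+ 2 != 0 by rewrite expf_neq0.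
  split=> [[h0 h1 _ h3]|[h0 h1 hf]].
    split.
    - by apply: (mulfI v02); rewrite mulr0 -h0; ring.
    - by apply: (mulfI v02); rewrite mulr0 -h1; ring.
    - by apply: (mulfI v00); rewrite mulr0 -h3; ring.
  split.
  - by rewrite -(mulr0 (v0 ^+ 2)) -h0; ring.
  - by rewrite -(mulr0 (v0 ^+ 2)) -h1; ring.
  - rewrite mulr0 addr0 /qform.
    have -> : 2%:R * (e2 * u0 ^+ 2 + e1 * u0 * u1 + e0 * u1 ^+ 2) * v0 =
      v0 * (u0 * (2%:R * e2 * u0 + e1 * u1) + u1 * (e1 * u0 +
        2%:R * e0 * u1)) by ring.
    by rewrite h0 h1 !mulr0 addr0 mulr0.
  - by rewrite hf; ring.
set a := v0 / v1; have v0E : v0 = a * v1 by rewrite /a divfK.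
have rowE i : qform (c i 0) (c i 1) (c i 2) v0 v1 = v1 ^+ 2 * (kp i).[a].
  by rewrite kpoly_horner v0E /qform; ring.
rewrite !rowE v0E.
have v12 : v1 ^+ 2 != 0 by rewrite expf_neq0.
have colE : 2%:R * qform (c 0 2) (c 1 2) (c 2 2) u0 u1 * (a * v1) +
      qform (c 0 1) (c 1 1) (c 2 1) u0 u1 * v1 =
    v1 * qform (kp 0)^`().[a] (kp 1)^`().[a] (kp 2)^`().[a] u0 u1.
  by rewrite !kpoly_deriv /qform; ring.
split=> [[h0 h1 h2 h3]|[h0 h1 hf]].
  split.
  - by apply: (mulfI v12); rewrite mulr0 -h0; ring.
  - by apply: (mulfI v12); rewrite mulr0 -h1; ring.
  - by apply: (mulfI v10); rewrite mulr0 -colE.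
split.
- by rewrite -(mulr0 (v1 ^+ 2)) -h0; ring.
- by rewrite -(mulr0 (v1 ^+ 2)) -h1; ring.
- by rewrite colE hf mulr0.
have euler : qform (c 0 1) (c 1 1) (c 2 1) u0 u1 * (a * v1) +
   2%:R * qform (c 0 0) (c 1 0) (c 2 0) u0 u1 * v1 =
   2%:R * v1 * qform (kp 0).[a] (kp 1).[a] (kp 2).[a] u0 u1 -
   a * (v1 * qform (kp 0)^`().[a] (kp 1)^`().[a] (kp 2)^`().[a] u0 u1).
  by rewrite !kpoly_horner !kpoly_deriv /qform; ring.
rewrite euler hf mulr0 mulr0 subr0.
have -> : 2%:R * v1 * qform (kp 0).[a] (kp 1).[a] (kp 2).[a] u0 u1 =
  v1 * (u0 * (2%:R * (kp 2).[a] * u0 + (kp 1).[a] * u1) +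
        u1 * ((kp 1).[a] * u0 + 2%:R * (kp 0).[a] * u1)).
  by rewrite /qform; ring.
by rewrite h0 h1 !mulr0 addr0 mulr0.
Qed.

End Point.
End Geometry.

(** * Exchanging the two variables *)

Section Transpose.
Variables (k : fieldType) (d : 'I_3 -> 'I_3 -> k) (t : k).

(** The transposed model has the original Delta_1 as its Delta_2. *)
Definition transpose_weights : 'I_3 -> 'I_3 -> k := fun i j => d j i.
Local Notation d' := transpose_weights.

Lemma kernel_coef (e : 'I_3 -> 'I_3 -> k) i :
  (kernel e t)`_i = match i with
  | 0%N => kpoly e t 0 | 1%N => kpoly e t 1 | 2%N => kpoly e t 2 | _ => 0
  end.
Proof.
rewrite kernelE !coefD !coefCM coefXn coefX coefC.
by case: i => [|[|[|i]]] /=; rewrite ?mulr0 ?mulr1 ?addr0 ?add0r.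
Qed.

Lemma kcoef_transpose i j : kcoef d' t i j = kcoef d t j i.
Proof. by rewrite /kcoef andbC. Qed.

Lemma kernel_transpose : kernel d' t = swapXY (kernel d t).
Proof.
apply/polyP=> i; apply/polyP=> j; rewrite coef_swapXY !kernel_coef.
have c3 e l n : (kpoly e t l)`_n.+3 = 0 by rewrite nth_default // (leq_trans
  (size_kpoly e t l)).
have kE e l := kpoly_coef e t l.
have [a0 a1 a2] := kE d 0; have [b0 b1 b2] := kE d 1; have [c0 c1 c2] := kE d 2.
have [a0' a1' a2'] := kE d' 0; have [b0' b1' b2'] := kE d' 1;
  have [c0' c1' c2'] := kE d' 2.
by case: i j => [|[|[|i]]] [|[|[|j]]];
  rewrite ?coef0 ?c3 ?a0 ?a1 ?a2 ?b0 ?b1 ?b2 ?c0 ?c1 ?c2 ?a0' ?a1' ?a2'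
    ?b0' ?b1' ?b2' ?c0' ?c1' ?c2' ?kcoef_transpose.
Qed.

Lemma unit_swapXY (p : {poly {poly k}}) :
  swapXY p \is a GRing.unit -> p \is a GRing.unit.
Proof.
move=> /unitrPr[q e]; apply/unitrPr; exists (swapXY q).
by rewrite -[p]swapXYK -(rmorphM (@swapXY k)) e (rmorph1 (@swapXY k)).
Qed.

Lemma reducible_swapXY (p : {poly {poly k}}) : reducible (swapXY p) ->
  reducible p.
Proof.
move=> [q [r [qU rU e]]]; exists (swapXY q), (swapXY r); split.
- by apply: contra qU; apply: unit_swapXY.
- by apply: contra rU; apply: unit_swapXY.
- by rewrite -(rmorphM (@swapXY k)) -e /= swapXYK.
Qed.

Lemma nondegenerate_transpose : nondegenerate_model d t ->
  nondegenerate_model d' t.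
Proof.
move=> nd dg; apply: nd; case: dg; rewrite kernel_transpose.
- by move/reducible_swapXY; apply: Or31.
- by rewrite -sizeYE; apply: Or33.
- by rewrite sizeYE swapXYK; apply: Or32.
Qed.

Lemma singularity_transpose (P : P1 k * P1 k) : (2%:R : k) != 0 ->
  singularity d t P <-> singularity d' t (P.2, P.1).
Proof.
move=> two0; have e1 := singularityP d t P two0.
have e2 := singularityP d' t (P.2, P.1) two0.
apply: (iff_trans e1); apply: iff_sym; apply: (iff_trans e2).
by rewrite !kcoef_transpose /=; split=> [[]|[]].
Qed.

End Transpose.

(** * Nondegenerate models *)

Section Nondegenerate.
Variables (k : closedFieldType).
Hypothesis two_neq0 : (2%:R : k) != 0.
Variables (d : 'I_3 -> 'I_3 -> k) (t : k).
Local Notation c := (kcoef d t).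
Local Notation kp := (kpoly d t).
Local Notation D := (kdisc d t).
Hypothesis nondeg : nondegenerate_model d t.

Lemma kernel_irreducible :
  ~ reducible ((kp 2)%:P * 'X^2 + (kp 1)%:P * 'X + (kp 0)%:P).
Proof. by rewrite -kernelE => red; apply: nondeg; apply: Or31. Qed.

Lemma kpoly2_neq0 : kp 2 != 0.
Proof.
apply/eqP=> k20; apply: nondeg; apply: Or32.
rewrite kernelE k20 mul0r add0r size_MXaddC; case: ifP => // _.
by rewrite ltnS size_polyC leq_b1.
Qed.

(** Otherwise the kernel would be reducible. *)
Lemma kdisc_nonsquare S : D <> S ^+ 2.
Proof. exact: (disc_nonsquare two_neq0 kernel_irreducible kpoly2_neq0). Qed.

Lemma kdisc_neq0 : D != 0.
Proof. by apply/eqP=> D0; apply: (@kdisc_nonsquare 0); rewrite D0 expr0n. Qed.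

Lemma kdisc_nonscaled S e : D <> e *: S ^+ 2.
Proof. by move/scaled_square=> [T]; apply: kdisc_nonsquare. Qed.

(** A common zero of A, B and C gives a factor of the kernel, or a drop of its
    degree in y if the zero is at infinity. *)
Lemma kpoly_no_common_zero u v :
  [|| jet0 u v (kp 0) != 0, jet0 u v (kp 1) != 0 | jet0 u v (kp 2) != 0].
Proof.
apply: contra_notT nondeg; rewrite !negb_or !negbK /jet0.
have [v0|v0] := eqVneq v 0 => /= /and3P[/eqP z0 /eqP z1 /eqP z2].
  apply: Or33.
  have s2 i : (kp i)`_2 = 0 -> (size (kp i) <= 2)%N.
    move=> zi; apply/leq_sizeP => -[|[|[|j]]] // _.
    by rewrite nth_default // (leq_trans (size_kpoly d t i)).
  rewrite /sizeY; apply/bigmax_leqP => i _; rewrite kernel_coef.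
  by case: (nat_of_ord i) => [|[|[|j]]]; rewrite ?s2 ?size_poly0.
apply: Or31; move: z0 z1 z2; set a := u / v.
move=> /rootP/factor_theorem[q0 e0] /rootP/factor_theorem[q1 e1]
  /rootP/factor_theorem[q2 e2].
exists (q2%:P * 'X^2 + q1%:P * 'X + q0%:P), ('X - a%:P)%:P; split.
- apply: nonunit_size; have := quadratic_size q1 q0 (A := q2) => -> //.
  by apply: contraNneq kpoly2_neq0 => q20; rewrite e2 q20 mul0r.
- by rewrite poly_unitE size_polyC coefC /= polyXsubC_eq0 /= poly_unitE
  size_XsubC.
- by rewrite kernelE e0 e1 e2 !polyCM; ring.
Qed.

Lemma singularity_mult_ge2 P : singularity d t P ->
  mult_ge 2 4 D (hcoord0 P.2) (hcoord1 P.2).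
Proof.
move=> /(singularity_jet two_neq0)[h0 h1 hf]; apply/mult_ge2_jet.
exact: singular_disc_jet (hcoord_neq0 P.1) h0 h1 hf.
Qed.

(** The fibre over a multiple root of the discriminant consists of one point,
    and it is singular. *)
Lemma mult_ge2_singularity (Q : P1 k) : mult_ge 2 4 D (hcoord0 Q) (hcoord1 Q) ->
  exists P, singularity d t P.
Proof.
move=> /mult_ge2_jet[h0 h1].
have [x0 [x1 [x_neq0 g0 g1 gf]]] :=
  disc_jet_singular two_neq0 (kpoly_no_common_zero _ _) h0 h1.
have [P1 [s [s0 p0 p1]]] := P1_point x_neq0.
exists (P1, Q); apply/(singularity_jet two_neq0); rewrite /= p0 p1; split.
- by rewrite -(mulr0 s) -g0; ring.
- by rewrite -(mulr0 s) -g1; ring.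
- by rewrite -(mulr0 (s ^+ 2)) -gf /qform; ring.
Qed.

(** The two derivatives along each factor vanish because the corresponding
    quadratic form has a double root. *)
Lemma roots_singularity P : on_curve d t P -> is_root (Delta1 d t) P.1 ->
  is_root (Delta2 d t) P.2 -> singularity d t P.
Proof.
rewrite /on_curve eval4_kernel => onP r1 r2.
have /= := (Delta2_eval (transpose_weights d) t (P.2, P.1)).1 r1.
rewrite !(kcoef_transpose d) => disc1.
have disc2 := (Delta2_eval d t P).1 r2.
have [h0 h1] := qform_double_root onP disc2.
apply/singularityP => //; split=> //.
  apply: (proj1 (qform_double_root _ disc1)); rewrite -onP /qform; ring.
by apply: (proj2 (qform_double_root _ disc1)); rewrite -onP /qform; ring.
Qed.

Lemma mult_ge_scale m n (p : {poly k}) s u v : s != 0 ->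
  mult_ge m n p (s * u) (s * v) = mult_ge m n p u v.
Proof.
move=> s0; rewrite /mult_ge mulf_eq0 (negPf s0) /=; case: eqP => //= /eqP v0.
by rewrite -mulf_div divff // mul1r.
Qed.

(** Then the discriminant is h L^2 where h has degree two and distinct roots,
    and the function field is that of the conic z^2 = h. *)
Lemma singular_genus0 : singular_curve d t -> kernel_curve_genus d t 0.
Proof.
move=> [P /singularity_mult_ge2 mP].
have [L [h [L0 DE sh h_sep r_sep]]] :=
  mult_ge2_separable_factor (size_kdisc d t) (hcoord_neq0 P.2) kdisc_nonsquare mP.
have [F [phi phiP]] := function_field_exists kernel_irreducible
  (quadratic_size _ _ kpoly2_neq0).
exists F, phi; rewrite kernelE; split=> //.
have H := hyperelliptic_of_quadratic two_neq0 kpoly2_neq0 phiP DE L0.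
exact: (hyperelliptic_genus (g := 0) two_neq0 H).
Qed.

Lemma smooth_genus1 (F : fieldType) (phi : {rmorphism {poly {poly k}} -> F}) :
  smooth_curve d t -> is_function_field (kernel d t) phi ->
  genus_of_function_field (fun e : k => phi e%:P%:P) 1.
Proof.
rewrite kernelE => smooth phiP.
have [D_sep r_sep] : separable_poly D /\ separable_poly (revp 4 D).
  apply: no_mult_ge2_separable (size_kdisc d t) kdisc_neq0 _ => u v uv0.
  apply/negP => m2; have [Q [s [s0 q0 q1]]] := P1_point uv0.
  have [|P singP] := @mult_ge2_singularity Q;
    first by rewrite q0 q1 mult_ge_scale.
  by apply: smooth; exists P.
have DE : D = D * 1 ^+ 2 by rewrite expr1n mulr1.
have H := hyperelliptic_of_quadratic two_neq0 kpoly2_neq0 phiP DE (oner_neq0 _).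
exact: (hyperelliptic_genus (g := 1) two_neq0 H (size_kdisc d t)).
Qed.

Lemma genus1_exists : smooth_curve d t -> kernel_curve_genus d t 1.
Proof.
move=> smooth; have [F [phi phiP]] := function_field_exists kernel_irreducible
  (quadratic_size _ _ kpoly2_neq0).
exists F, phi; rewrite -kernelE in phiP; split=> //; exact: smooth_genus1.
Qed.

(** On a smooth curve of genus one there is a nonzero regular differential,
    by the uniqueness of coordinates in a basis. This holds for whichever
    function field is used to compute the genus. *)
Lemma genus0_singular : kernel_curve_genus d t 0 -> singular_curve d t.
Proof.
move=> [F [phi [phiP [e0 _ e0P]]]]; apply: contrapT => smooth.
have [e1 e1R e1P] := smooth_genus1 smooth phiP.
have reg0 : regular_differential (fun=> 0 : F) (iota := fun e : k => phi e%:P%:P).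
  split=> [|O _]; first by exists [::] => E; rewrite /differential_of big_nil.
  by exists [::] => // E; rewrite /differential_of big_nil.
(* In genus 0 all regular differentials vanish, but then the coordinates with
   respect to e1 are not unique. *)
have e1_0 E : e1 0 E = 0.
  by have [a [aP _]] := e0P _ (e1R 0); rewrite aP big_ord0.
have [a [_ a_uniq]] := e1P _ reg0.
have sol (b : 'rV[k]_1) : a = b.
  by apply: a_uniq => E; rewrite big_ord1 e1_0 mulr0.
have := congr1 (fun M : 'rV[k]_1 => M 0 0)
  (etrans (esym (sol 0)) (sol (const_mx 1))).
by rewrite !mxE => /eqP; rewrite eq_sym oner_eq0.
Qed.

End Nondegenerate.

(** * Transcendence and triple roots *)

(** Unique factorization, with the roots of g cancelled one after the
    other. *)
Lemma square_of_mul_square (k : closedFieldType) (q g h : {poly k}) : g != 0 ->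
  q * g ^+ 2 = h ^+ 2 -> exists r, q = r ^+ 2.
Proof.
elim/ltn_ind: (size g) {-2}g (erefl (size g)) h => n IH {}g sg h g0 e.
have [sg1|sg1] := eqVneq (size g) 1%N.
  have /size_poly1P[b b0 gE] : size g == 1%N by rewrite sg1.
  exists (b^-1 *: h); rewrite exprZn -e gE -polyC_exp mulrC mul_polyC scalerA.
  by rewrite -exprMn mulVf // expr1n scale1r.
have /closed_rootP[a /factor_theorem[g1 gE]] := sg1.
have g10 : g1 != 0 by apply: contraNneq g0 => g10; rewrite gE g10 mul0r.
have : root (h ^+ 2) a.
  rewrite -e gE rootE hornerM horner_exp hornerM hornerXsubC.
  by rewrite subrr mulr0 expr0n mulr0.
rewrite rootE horner_exp sqrf_eq0 => /factor_theorem[h1 hE].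
apply: (IH (size g1) _ g1 erefl h1) => //.
  by rewrite -sg gE size_Mmonic ?monicXsubC // size_XsubC addn2.
have Xa0 : ('X - a%:P) ^+ 2 != 0 by rewrite expf_neq0 // polyXsubC_eq0.
by apply: (mulIf Xa0); rewrite -mulrA -!exprMn -gE -hE.
Qed.

Section Algebraic.
Variables (K0 k : fieldType) (f : {rmorphism K0 -> k}).
Local Notation alg := (algebraicOver f).

Lemma alg_poly_root (p : {poly k}) z : p != 0 -> (forall i, alg p`_i) ->
  root p z -> alg z.
Proof.
move=> p0 pA pz; apply/integral_algebraic.
pose p1 := (lead_coef p)^-1 *: p.
have p1_monic : p1 \is monic.
  by rewrite monicE lead_coefZ mulVf // lead_coef_eq0.
apply: (integral_root_monic p1_monic).
  by rewrite rootE hornerZ (rootP pz) mulr0.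
apply/integral_poly => i; apply/integral_algebraic; rewrite coefZ.
by apply: algebraic_mul => //; apply: algebraic_inv; apply: pA.
Qed.

Lemma alg_nat n : alg n%:R.
Proof. by rewrite -(rmorph_nat f); apply: algebraic_id. Qed.

Lemma alg_exp z n : alg z -> alg (z ^+ n).
Proof.
move=> zA; elim: n => [|n IH]; first exact: algebraic1.
by rewrite exprS; apply: algebraic_mul.
Qed.

Lemma alg_horner (p : {poly k}) z : (forall i, alg p`_i) -> alg z -> alg p.[z].
Proof.
move=> pA zA; rewrite horner_coef; elim/big_ind: _ => [||i _].
- exact: algebraic0.
- exact: algebraic_add.
- by apply: algebraic_mul => //; apply: alg_exp.
Qed.

Lemma alg_sqrt z : alg (z ^+ 2) -> alg z.
Proof.
move=> z2; apply: (@alg_poly_root ('X^2 - (z ^+ 2)%:P)).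
- by rewrite -size_poly_eq0 size_XnsubC.
- move=> i; rewrite coefB coefXn coefC; apply: algebraic_sub;
  first exact: alg_nat.
  by case: ifP => // _; apply: algebraic0.
- by rewrite rootE !hornerE subrr.
Qed.

Definition alg_poly (p : {poly k}) := forall i, alg p`_i.

Lemma alg_polyM p q : alg_poly p -> alg_poly q -> alg_poly (p * q).
Proof.
move=> pA qA i; rewrite coefM; elim/big_ind: _ => [||j _].
- exact: algebraic0.
- exact: algebraic_add.
- exact: algebraic_mul.
Qed.

Lemma alg_polyB p q : alg_poly p -> alg_poly q -> alg_poly (p - q).
Proof. by move=> pA qA i; rewrite coefB; apply: algebraic_sub. Qed.

Lemma alg_polyX : alg_poly 'X.
Proof. by move=> i; rewrite coefX; apply: alg_nat. Qed.

Lemma alg_deriv p : alg_poly p -> alg_poly p^`().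
Proof.
move=> pA i; rewrite coef_deriv -mulr_natl; apply: algebraic_mul => //.
exact: alg_nat.
Qed.

End Algebraic.

Section TripleRoot.
Variables (K0 : fieldType) (k : closedFieldType) (f : {rmorphism K0 -> k}).
Local Notation alg := (algebraicOver f).
Hypothesis two_neq0 : (2%:R : k) != 0.
Variable t : k.
Hypothesis t_tr : ~ alg t.

Lemma transcendental_linear a b : alg a -> alg b -> a + b * t = 0 -> a = 0.
Proof.
move=> aA bA e; have [b0|b0] := eqVneq b 0.
  by move: e; rewrite b0 mul0r addr0.
case: t_tr; have -> : t = - a / b.
  by apply: (mulIf b0); rewrite divfK // mulrC; apply/eqP;
    rewrite -addr_eq0 addrC e.
by apply: algebraic_div => //; apply: algebraic_opp.
Qed.

Lemma transcendental_neq0 : t != 0.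
Proof. by apply/eqP=> t0; apply: t_tr; rewrite t0; apply: algebraic0. Qed.

(** Extracting square roots turns a quadratic equation for t with
    algebraic coefficients into a linear one. *)
Lemma transcendental_square a b r : alg a -> alg b -> alg r ->
  (a - t * b) ^+ 2 = 4%:R * t ^+ 2 * r -> a = 0.
Proof.
move=> aA bA rA e; have [s sE] := closed_sqrt r.
have sA : alg s by apply: alg_sqrt; rewrite sE.
have two_sA : alg (2%:R * s) by apply: algebraic_mul => //; apply: alg_nat.
have : (a - t * b) ^+ 2 == (2%:R * s * t) ^+ 2.
  by rewrite e -sE; apply/eqP; ring.
rewrite eqf_sqr => /orP[] /eqP e1.
- apply: (@transcendental_linear a (- b - 2%:R * s)) => //.
    by apply: algebraic_sub => //; apply: algebraic_opp.
  have -> : a + (- b - 2%:R * s) * t = (a - t * b) - 2%:R * s * t by ring.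
  by rewrite e1 subrr.
- apply: (@transcendental_linear a (- b + 2%:R * s)) => //.
    by apply: algebraic_add => //; apply: algebraic_opp.
  have -> : a + (- b + 2%:R * s) * t = (a - t * b) + 2%:R * s * t by ring.
  by rewrite e1 addNr.
Qed.

Variables b q : {poly k}.
Hypothesis (bA : alg_poly f b) (qA : alg_poly f q).
Hypothesis (sb : (size b <= 3)%N) (sq : (size q <= 5)%N).
Let D : {poly k} := ('X - t *: b) ^+ 2 - (4%:R * t ^+ 2) *: q.
Hypothesis D_nsq : forall S : {poly k}, D <> S ^+ 2.

(** The hypotheses say that the coefficients D_1 and D_2 vanish, if b0 and b1
    are the lowest coefficients of b, or that D_3 and D_2 vanish, if b0 and b1
    are b_2 and b_1. The first equation forces b0 = 0, after which the second
    one is a quadratic equation for t. *)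
Lemma no_triple_at_corner b0 b1 b2 q1 q2 : alg b0 -> alg b1 -> alg q1 -> alg q2 ->
  2%:R * b0 * (1 - t * b1) + 4%:R * t * q1 = 0 ->
  (1 - t * b1) ^+ 2 + 2%:R * t ^+ 2 * b0 * b2 - 4%:R * t ^+ 2 * q2 = 0 -> False.
Proof.
move=> b0A b1A q1A q2A e1 e2.
have b00 : 2%:R * b0 = 0.
  apply: (@transcendental_linear _ (4%:R * q1 - 2%:R * b0 * b1)).
  - by apply: algebraic_mul => //; apply: alg_nat.
  - by apply: algebraic_sub; do ?apply: algebraic_mul => //; apply: alg_nat.
  - by rewrite -e1; ring.
have := oner_neq0 k; rewrite (@transcendental_square 1 b1 q2) ?eqxx //;
  first exact: algebraic1.
apply/eqP; rewrite -subr_eq0 -e2; apply/eqP.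
have -> : 2%:R * t ^+ 2 * b0 * b2 = t ^+ 2 * b2 * (2%:R * b0) by ring.
by rewrite b00 mulr0 addr0.
Qed.

(** Elimination of t from D(p) = D'(p) = 0 gives E(p) = 0 for a polynomial E
    with algebraic coefficients. If E is not zero, then p is algebraic, and
    so is t. If E = 0, then D is a square or D has the root 0, and explicit
    formulas lead to a quadratic equation for t. *)
Lemma no_double_off_corners p : p != 0 -> D.[p] = 0 -> D^`().[p] = 0 -> False.
Proof.
move=> p0; set B := b.[p]; set B' := b^`().[p]; set Q := q.[p];
  set Q' := q^`().[p].
have -> : D.[p] = (p - t * B) ^+ 2 - 4%:R * t ^+ 2 * Q.
  by rewrite /D hornerD hornerN horner_exp !hornerZ hornerD hornerN hornerZ
    hornerX.
have -> : D^`().[p] = 2%:R * (p - t * B) * (1 - t * B') - 4%:R * t ^+ 2 * Q'.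
  rewrite /D expr2 derivB derivM !(derivB, derivZ, derivX) -polyC1.
  by rewrite !(hornerD, hornerN, hornerM, hornerZ, hornerX,
    hornerC) -/B -/B' -/Q'; ring.
move=> e0 e1.
have t0 := transcendental_neq0.
have four0 : (4%:R : k) != 0 by rewrite (natrM _ 2 2) mulf_neq0.
(* Euler's operator p d/dp combines the equations (p - t b)^2 = 4 t^2 q and
   2 (p - t b) (1 - t b') = 4 t^2 q' into one that is linear in t:
   (p - t b) (b - p b') = 2 t (p q' - 2 q). *)
pose E := q * (b - 'X * b^`()) ^+ 2 - ('X * q^`() - (q + q)) ^+ 2.
have Ep : root E p.
  rewrite rootE /E !(horner_exp, hornerD, hornerN, hornerM,
    hornerX) -/B -/B' -/Q -/Q'.
  have -> : Q * (B - p * B') ^+ 2 - (p * Q' - (Q + Q)) ^+ 2 = 0 => //.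
  have w2 : (p - t * B) ^+ 2 = 4%:R * t ^+ 2 * Q by apply/eqP;
    rewrite -subr_eq0 e0.
  have ww : 2%:R * (p - t * B) * (1 - t * B') = 4%:R * t ^+ 2 * Q' by apply/eqP;
    rewrite -subr_eq0 e1.
  have l : 2%:R * t * ((p - t * B) * (B - p * B')) =
    2%:R * t * (2%:R * t * (p * Q' - (Q + Q))).
    have -> : 2%:R * t * ((p - t * B) * (B - p * B')) =
      p * (2%:R * (p - t * B) * (1 - t * B')) - 2%:R * (p - t * B) ^+ 2 by ring.
    by rewrite w2 ww; ring.
  have {}l := mulfI (mulf_neq0 two_neq0 t0) l.
  have c0 : 4%:R * t ^+ 2 != 0 by rewrite mulf_neq0 ?expf_neq0.
  apply: (mulfI c0).
  have -> : 4%:R * t ^+ 2 * (Q * (B - p * B') ^+ 2 - (p * Q' - (Q + Q)) ^+ 2) =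
    4%:R * t ^+ 2 * Q * (B - p * B') ^+ 2 - (2%:R * t * (p * Q' - (Q +
      Q))) ^+ 2 by ring.
  by rewrite -l -w2; ring.
have [E0|E0] := eqVneq E 0; last first.
  have pA : alg p.
    apply: (alg_poly_root E0 _ Ep); rewrite /E !expr2.
    have XbA : alg_poly f ('X * b^`()) by apply: alg_polyM;
      [apply: alg_polyX|apply: alg_deriv].
    have XqA : alg_poly f ('X * q^`()) by apply: alg_polyM;
      [apply: alg_polyX|apply: alg_deriv].
    have qqA : alg_poly f (q + q) by move=> i; rewrite coefD;
      apply: algebraic_add.
    apply: alg_polyB; first by do !apply: alg_polyM => //; apply: alg_polyB.
    by apply: alg_polyM; apply: alg_polyB.
  case/negP: p0; apply/eqP; apply: (@transcendental_square p B Q) => //.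
  - exact: alg_horner.
  - exact: alg_horner.
  - by apply/eqP; rewrite -subr_eq0 e0.
have bX : b - 'X * b^`() = (b`_0)%:P - b`_2 *: 'X^2.
  apply/polyP=> i; rewrite !coefB coefZ coefXM coefC coefXn coef_deriv.
  case: i => [|[|[|i]]] /=; rewrite ?mulr0 ?mulr1 ?subr0 ?sub0r ?mulr1n ?subrr //.
    by ring.
  by rewrite nth_default ?(leq_trans sb) // mul0rn subrr.
move/eqP: E0; rewrite subr_eq0 => /eqP E0.
(* First case: b is a multiple of y and q one of y^2, so that D is one of y^2. *)
have [g0|g0] := eqVneq (b - 'X * b^`()) 0.
  have bi i : i != 1%N -> b`_i = 0.
    move: g0; rewrite bX => g0.
    have := congr1 (fun u : {poly k} => u`_0) g0.
    have := congr1 (fun u : {poly k} => u`_2) g0.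
    rewrite !coefB !coefZ !coefC !coefXn /= mulr0 mulr1 subr0 sub0r.
    move=> /eqP; rewrite oppr_eq0 => /eqP b2 b0'.
    by case: i => [|[|[|i]]] // _; rewrite nth_default // (leq_trans sb).
  have qi i : i != 2%N -> q`_i = 0.
    move: E0; rewrite g0 expr0n mulr0 => /esym/eqP;
      rewrite sqrf_eq0 => /eqP h0 i2.
    have := congr1 (fun u : {poly k} => u`_i) h0.
    rewrite coefB coefXM coefD coef0 coef_deriv.
    case: i i2 => [|[|[|[|[|i]]]]] //= _.
    - by rewrite sub0r -mulr2n -mulr_natl => /eqP;
      rewrite oppr_eq0 mulf_eq0 (negPf two_neq0) => /eqP.
    - by rewrite mulr1n opprD addrA subrr sub0r => /eqP; rewrite oppr_eq0 => /eqP.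
    - by move=> e3; rewrite -[RHS]e3; ring.
    - by move=> e4; apply: (mulfI two_neq0); rewrite mulr0 -[RHS]e4; ring.
    - by move=> _; rewrite nth_default // (leq_trans sq).
  have bE : b = b`_1 *: 'X.
    apply/polyP=> i; rewrite coefZ coefX; case: eqVneq => [->|/bi ->].
      by rewrite mulr1.
    by rewrite mulr0.
  have qE : q = q`_2 *: 'X^2.
    apply/polyP=> i; rewrite coefZ coefXn; case: eqVneq => [->|/qi ->].
      by rewrite mulr1.
    by rewrite mulr0.
  have : D = ((1 - t * b`_1) ^+ 2 - 4%:R * t ^+ 2 * q`_2) *: 'X ^+ 2.
    rewrite /D {1}bE {1}qE !scalerA.
    have -> : 'X - (t * b`_1) *: 'X = (1 - t *
      b`_1) *: 'X by rewrite scalerBl scale1r.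
    rewrite exprZn.
    by rewrite -scalerBl.
  by case/scaled_square=> T; apply: D_nsq.
(* Second case: q = s^2, and E = 0 becomes Euler's equation u = y u' for
   u = b + 2 s, after a choice of sign of s. Hence u = cc y, and D is the
   product of (1 - t cc) y and m = (1 - t cc) y + 4 t s. *)
have [r rE] := square_of_mul_square g0 E0.
have [r0|r0] := eqVneq r 0.
  by case: (D_nsq (S := 'X - t *: b)); rewrite /D rE r0 expr0n scaler0 subr0.
have sr : (size r <= 3)%N.
  have := size_exp r 2; rewrite -rE => sqE.
  have r_gt0 : (0 < size r)%N by rewrite size_poly_gt0.
  by move: sqE sq r_gt0; case: (size q) => [|m]; case: (size r) => [|n] //=; lia.
have [s sE bsE] :
  exists2 s, s ^+ 2 = q & (b + (s + s)) - 'X * (b + (s + s))^`() = 0.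
  have : (b - 'X * b^`()) ^+ 2 == (('X * r^`() - r) + ('X * r^`() - r)) ^+ 2.
    have r20 : r ^+ 2 != 0 by rewrite expf_neq0.
    apply/eqP/(mulfI r20); rewrite -{1}rE E0 rE expr2 derivM.
    by ring.
  rewrite eqf_sqr => /orP[] /eqP e.
    exists r; first by rewrite rE.
    rewrite !derivD; apply/eqP; rewrite -subr_eq0 subr0.
    have -> : b + (r + r) - 'X * (b^`() + (r^`() + r^`())) =
      (b - 'X * b^`()) - (('X * r^`() - r) + ('X * r^`() - r)) by ring.
    by rewrite e subrr.
  exists (- r); first by rewrite sqrrN rE.
  rewrite !derivD !derivN; apply/eqP.
  have -> : b + (- r + - r) - 'X * (b^`() + (- r^`() + - r^`())) =
    (b - 'X * b^`()) + (('X * r^`() - r) + ('X * r^`() - r)) by ring.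
  by rewrite e addNr.
have ss : (size s <= 3)%N.
  have /eqP : s ^+ 2 = r ^+ 2 by rewrite sE rE.
  by rewrite eqf_sqr => /orP[] /eqP ->; rewrite ?size_polyN.
have bs i : (b + (s + s))`_i *+ i = (b + (s + s))`_i.
  have := congr1 (fun u : {poly k} => u`_i) bsE.
  rewrite coefB coefXM coef0 coef_deriv; case: i => [|i] /=.
    by rewrite subr0 mulr0n => ->.
  by move=> /eqP; rewrite subr_eq0 => /eqP.
have bs0 : b`_0 = - (2%:R * s`_0).
  have := bs 0%N; rewrite mulr0n !coefD => /esym e.
  apply/eqP; rewrite -addr_eq0; apply/eqP.
  have -> : b`_0 + 2%:R * s`_0 = b`_0 + (s`_0 + s`_0) by ring.
  exact: e.
have bs2 : b`_2 = - (2%:R * s`_2).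
  have := bs 2%N; rewrite !coefD mulr2n => e.
  apply/eqP; rewrite -addr_eq0; apply/eqP.
  have -> : b`_2 + 2%:R * s`_2 = (b`_2 + (s`_2 + s`_2)) + (b`_2 + (s`_2 +
    s`_2)) - (b`_2 + (s`_2 + s`_2)) by ring.
  by rewrite e subrr.
have sA0 : alg s`_0.
  have -> : s`_0 = - b`_0 / 2%:R by rewrite bs0; field.
  by apply: algebraic_div; [apply: algebraic_opp|apply: alg_nat].
have sA2 : alg s`_2.
  have -> : s`_2 = - b`_2 / 2%:R by rewrite bs2; field.
  by apply: algebraic_div; [apply: algebraic_opp|apply: alg_nat].
have [_ _ s2E _ _] := coefM_quadratics ss ss.
have sA1 : alg s`_1.
  apply: alg_sqrt; have -> : s`_1 ^+ 2 = q`_2 - 2%:R * (s`_0 * s`_2).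
    by rewrite -sE expr2 [in RHS]s2E; ring.
  apply: algebraic_sub => //; apply: algebraic_mul; first exact: alg_nat.
  exact: algebraic_mul.
have s_val : s.[p] = s`_0 + s`_1 * p + s`_2 * p ^+ 2.
  by rewrite {1}(quadraticE ss) !hornerE.
have s'_val : s^`().[p] = s`_1 + 2%:R * s`_2 * p.
  rewrite {1}(quadraticE ss) !(derivD, derivC, derivZ, derivX, derivXn) /= add0r.
  by rewrite !(hornerD, hornerZ, hornerMn, hornerX, hornerC) -mulr_natl; ring.
have b_val : b.[p] = b`_0 + b`_1 * p + b`_2 * p ^+ 2.
  by rewrite {1}(quadraticE sb) !hornerE.
have b'_val : b^`().[p] = b`_1 + 2%:R * b`_2 * p.
  rewrite {1}(quadraticE sb) !(derivD, derivC, derivZ, derivX, derivXn) /= add0r.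
  by rewrite !(hornerD, hornerZ, hornerMn, hornerX, hornerC) -mulr_natl; ring.
set cc := b`_1 + 2%:R * s`_1.
have ccA : alg cc.
  by apply: algebraic_add => //; apply: algebraic_mul => //; apply: alg_nat.
have B_val : B = cc * p - 2%:R * s.[p].
  by rewrite /B b_val bs0 bs2 s_val /cc; ring.
have B'_val : B' = cc - 2%:R * s^`().[p].
  by rewrite /B' b'_val bs2 s'_val /cc; ring.
have Q_val : Q = s.[p] ^+ 2 by rewrite /Q -sE horner_exp.
have Q'_val : Q' = 2%:R * s.[p] * s^`().[p].
  by rewrite /Q' -sE expr2 derivM hornerD !hornerM; ring.
have tcc : 1 - t * cc != 0.
  apply/eqP=> e; have := oner_neq0 k.
  rewrite (@transcendental_linear 1 (- cc)) ?eqxx //; first exact: algebraic1.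
    exact: algebraic_opp.
  by rewrite mulNr mulrC.
pose m0 := 4%:R * t * s`_0; pose m1 := 1 - t * cc + 4%:R * t * s`_1;
  pose m2 := 4%:R * t * s`_2.
have mp : m0 + m1 * p + m2 * p ^+ 2 = 0.
  apply: (mulfI (mulf_neq0 tcc p0)); rewrite mulr0 -e0 B_val Q_val s_val.
  by rewrite /m0 /m1 /m2; ring.
have m'p : m1 + 2%:R * m2 * p = 0.
  apply: (mulfI (mulf_neq0 tcc p0)); rewrite mulr0.
  have -> : (1 - t * cc) * p * (m1 + 2%:R * m2 * p) =
    2%:R * (p - t * B) * (1 - t * B') - 4%:R * t ^+ 2 * Q'
     - (1 - t * cc) * (m0 + m1 * p + m2 * p ^+ 2).
    rewrite B_val B'_val Q'_val s_val s'_val /m0 /m1 /m2; ring.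
  by rewrite e1 mp mulr0 subrr.
(* m has a double root at p, so that its discriminant vanishes. *)
have m_disc : m1 ^+ 2 = 4%:R * m0 * m2.
  apply/eqP; rewrite -subr_eq0; apply/eqP.
  have -> : m1 ^+ 2 - 4%:R * m0 * m2 = (m1 + 2%:R * m2 * p) ^+ 2 -
    4%:R * m2 * (m0 + m1 * p + m2 * p ^+ 2) by ring.
  by rewrite mp m'p; ring.
have := oner_neq0 k; rewrite (@transcendental_square 1 (cc -
  4%:R * s`_1) (16%:R * (s`_0 * s`_2))) ?eqxx //.
- exact: algebraic1.
- by apply: algebraic_sub => //; apply: algebraic_mul => //; apply: alg_nat.
- by apply: algebraic_mul; [apply: alg_nat|apply: algebraic_mul].
transitivity (m1 ^+ 2); first by rewrite /m1; ring.
by rewrite m_disc /m0 /m2; ring.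
Qed.

(** The cases are: the root at infinity, the root 0, and the other ones, which
    are not even double. *)
Theorem no_triple_root (u v : k) : ~~ mult_ge 3 4 D u v.
Proof.
have s2 : (size (t *: b) <= 3)%N by rewrite (leq_trans (size_scale_leq _ _)).
have sX : (size ('X - t *: b)%R <= 3)%N.
  by rewrite (leq_trans (size_polyD _ _)) // geq_max size_polyN size_polyX.
have [w0 w1 w2 w3 w4] := coefM_quadratics sX sX.
have D1 : D`_1 = - t * (2%:R * b`_0 * (1 - t * b`_1) + 4%:R * t * q`_1).
  rewrite /D coefB coefZ expr2 w1 !coefB !coefZ !coefX /=; ring.
have D2 : D`_2 = (1 - t * b`_1) ^+ 2 + 2%:R * t ^+ 2 * b`_0 * b`_2 -
  4%:R * t ^+ 2 * q`_2.
  rewrite /D coefB coefZ expr2 w2 !coefB !coefZ !coefX /=; ring.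
have D3 : D`_3 = - t * (2%:R * b`_2 * (1 - t * b`_1) + 4%:R * t * q`_3).
  rewrite /D coefB coefZ expr2 w3 !coefB !coefZ !coefX /=; ring.
have nt0 : - t != 0 by rewrite oppr_eq0 transcendental_neq0.
apply/negP; rewrite /mult_ge; have [v0|v0] := eqVneq v 0; rewrite /=.
  move=> sD; have D20 : D`_2 = 0 by rewrite nth_default.
  have D30 : D`_3 = 0 by rewrite nth_default // (leq_trans sD).
  apply: (@no_triple_at_corner b`_2 b`_1 b`_0 q`_3 q`_2) => //.
    by apply: (mulfI nt0); rewrite mulr0 -D3.
  by rewrite -[RHS]D20 D2; ring.
have [u0|u0] := eqVneq u 0.
  rewrite u0 mul0r polyC0 subr0 => /dvdpP[h DE].
  have D10 : D`_1 = 0 by rewrite DE coefMXn.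
  have D20 : D`_2 = 0 by rewrite DE coefMXn.
  apply: (@no_triple_at_corner b`_0 b`_1 b`_2 q`_1 q`_2) => //.
    by apply: (mulfI nt0); rewrite mulr0 -D1.
  by rewrite -[RHS]D20 D2; ring.
move=> /dvdpP[h DE]; apply: (@no_double_off_corners (u / v)).
- by rewrite mulf_neq0 ?invr_eq0.
- by rewrite DE hornerM horner_exp hornerXsubC subrr expr0n mulr0.
rewrite DE exprS expr2 !(derivM, derivB, derivX, derivC).
by rewrite !(hornerD, hornerM, hornerN, hornerX, hornerC) subrr; ring.
Qed.

End TripleRoot.

(** * Kernel curves over an algebraically closed field *)

Lemma double_root_is_root (k : fieldType) (g : {mpoly k[2]}) (P : P1 k) :
  double_root g P -> is_root g P.
Proof.
move=> [[h ->] _]; rewrite /is_root mevalM expr2 mevalM.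
suff -> : (linear_form P).@[tnth [tuple hcoord0 P;
  hcoord1 P]] = 0 by rewrite !mulr0.
rewrite /linear_form mevalB !mevalZ !mevalXU.
by rewrite -[tnth _ 0]/(hcoord0 P) -[tnth _ 1]/(hcoord1 P) mulrC subrr.
Qed.

Section Main.
Variables (K0 : fieldType) (k : closedFieldType) (f : {rmorphism K0 -> k}).
Hypothesis two_neq0 : (2%:R : k) != 0.

(** With a, b, c the rows of weights, the discriminant is
    (y - t b)^2 - 4 t^2 a c. *)
Lemma kdisc_no_triple (d : 'I_3 -> 'I_3 -> k) (t : k) :
  (forall i j, algebraicOver f (d i j)) -> ~ algebraicOver f t ->
  nondegenerate_model d t -> forall u v, ~~ mult_ge 3 4 (kdisc d t) u v.
Proof.
move=> dA tT nd u v.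
pose wp i : {poly k} := (d i 0)%:P + d i 1 *: 'X + d i 2 *: 'X^2.
have wA i : alg_poly f (wp i).
  move=> j; rewrite /wp !coefD !coefZ coefC coefX coefXn.
  by case: j => [|[|[|j]]] /=; rewrite ?mulr0 ?mulr1 ?addr0 ?add0r //;
    apply: algebraic0.
have sw i : (size (wp i) <= 3)%N.
  apply/leq_sizeP => -[|[|[|j]]] // _.
  by rewrite !coefD !coefZ coefC coefX coefXn /= !mulr0 !addr0.
have DE : kdisc d t = ('X - t *: wp 1) ^+ 2 - (4%:R * t ^+ 2) *: (wp 2 * wp 0).
  rewrite /kdisc /kpoly /kcoef /wp !ord0E !ord1E !ord2E /= -!mul_polyC.
  rewrite !(polyCD, polyCM, polyCN) polyC_natr ?polyC_exp ?polyC0 ?polyC1.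
  by ring.
have := @no_triple_root K0 k f two_neq0 t tT (wp 1) (wp 2 * wp 0) (wA 1)
  (alg_polyM (wA 2) (wA 0)) (sw 1) (size_mul_quadratics (sw 2) (sw 0)).
rewrite -DE; apply => S; exact: kdisc_nonsquare.
Qed.

Variables (d : 'I_3 -> 'I_3 -> k) (t : k).
Hypothesis d_alg : forall i j, algebraicOver f (d i j).
Hypothesis t_trans : ~ algebraicOver f t.
Hypothesis nondeg : nondegenerate_model d t.
Local Notation d' := (transpose_weights d).

Let nondeg' : nondegenerate_model d' t := nondegenerate_transpose nondeg.

Lemma double_root_Delta2 Q : double_root (Delta2 d t) Q <->
  mult_ge 2 4 (kdisc d t) (hcoord0 Q) (hcoord1 Q).
Proof.
by rewrite Delta2E; apply: double_root_mult_ge (size_kdisc d t) (kdisc_no_triple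
  d_alg _ _ _ _).
Qed.

Lemma double_root_Delta1 Q : double_root (Delta1 d t) Q <->
  mult_ge 2 4 (kdisc d' t) (hcoord0 Q) (hcoord1 Q).
Proof.
rewrite -[Delta1 d t]/(Delta2 d' t) Delta2E.
by apply: double_root_mult_ge (size_kdisc d' t) (kdisc_no_triple _ _ _ _ _) => //
  i j; apply: d_alg.
Qed.

Lemma singularity_double P : singularity d t P ->
  double_root (Delta1 d t) P.1 /\ double_root (Delta2 d t) P.2.
Proof.
move=> sing; split; last by apply/double_root_Delta2; apply: singularity_mult_ge2.
apply/double_root_Delta1; move/(singularity_transpose _ _ _ two_neq0): sing.
exact: singularity_mult_ge2.
Qed.

(** Each discriminant has at most one multiple root. *)
Lemma double_unique P P' : double_root (Delta1 d t) P.1 ->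
  double_root (Delta2 d t) P.2 ->
  double_root (Delta1 d t) P'.1 -> double_root (Delta2 d t) P'.2 -> P = P'.
Proof.
case: P P' => [P Q] [P' Q'] /= /double_root_Delta1 m1 /double_root_Delta2 m2
  /double_root_Delta1 m1' /double_root_Delta2 m2'.
congr pair; apply: P1_eq.
  apply: (mult_ge2_unique (D := kdisc d' t)) m1 m1';
    rewrite ?size_kdisc ?hcoord_neq0 //.
  exact: kdisc_nonscaled.
apply: (mult_ge2_unique (D := kdisc d t)) m2 m2';
  rewrite ?size_kdisc ?hcoord_neq0 //.
exact: kdisc_nonscaled.
Qed.

Theorem genus0_equivalences :
  [<-> kernel_curve_genus d t 0;
       singular_curve d t;
       exists! P, singularity d t P;
       exists P, [/\ on_curve d t P, is_root (Delta1 d t) P.1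
                   & is_root (Delta2 d t) P.2];
       exists P, [/\ on_curve d t P, double_root (Delta1 d t) P.1
                   & double_root (Delta2 d t) P.2]].
Proof.
tfae.
- exact: genus0_singular.
- move=> [P sing]; exists P; split=> // P' sing'.
  have [a b] := singularity_double sing; have [a' b'] := singularity_double sing'.
  exact: double_unique.
- move=> [P [sing _]]; exists P; have [a b] := singularity_double sing.
  by split; [case: sing|apply: double_root_is_root|apply: double_root_is_root].
- move=> [P [onP r1 r2]]; exists P.
  have sing := roots_singularity two_neq0 onP r1 r2.
  by have [a b] := singularity_double sing.
- move=> [P [onP /double_root_is_root r1 /double_root_is_root r2]].
  apply: singular_genus0 => //; exists P.
  exact: (roots_singularity two_neq0 onP r1 r2).
Qed.

Theorem genus0_singularity : kernel_curve_genus d t 0 -> forall P,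
  singularity d t P <->
  double_root (Delta1 d t) P.1 /\ double_root (Delta2 d t) P.2.
Proof.
move=> /(genus0_singular two_neq0 nondeg)[P0 sing0] P; split;
  first exact: singularity_double.
move=> [a b]; have [a0 b0] := singularity_double sing0.
by rewrite (double_unique a b a0 b0).
Qed.

Theorem genus1_otherwise : ~ kernel_curve_genus d t 0 ->
  smooth_curve d t /\ kernel_curve_genus d t 1.
Proof.
move=> g0; have smooth : smooth_curve d t.
  by move=> sing; apply: g0; apply: singular_genus0.
by split=> //; apply: genus1_exists.
Qed.

End Main.

(** * The field generated by the weights *)

Section GeneratedField.
Variables (R : fieldType) (d : 'I_3 -> 'I_3 -> R).

Definition weight_field : {pred R} := fun x => `[< in_generated_field d x >].

Lemma weight_fieldP x : reflect (in_generated_field d x) (x \in weight_field).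
Proof. exact: asboolP. Qed.

Fact weight_field_divring : divring_closed weight_field.
Proof.
split.
- by apply/weight_fieldP => S [].
- move=> x y /weight_fieldP xS /weight_fieldP yS; apply/weight_fieldP => S SC dS.
  by case: (SC) => _ SB _; apply: SB; [apply: xS|apply: yS].
- move=> x y /weight_fieldP xS /weight_fieldP yS; apply/weight_fieldP => S SC dS.
  by case: (SC) => _ _ SD; apply: SD; [apply: xS|apply: yS].
Qed.

HB.instance Definition _ := GRing.isDivringClosed.Build R weight_field
  weight_field_divring.

Definition weight_field_type := {x : R | x \in weight_field}.
HB.instance Definition _ := SubChoice.on weight_field_type.
HB.instance Definition _ :=
  [SubChoice_isSubIntegralDomain of weight_field_type by <:].
HB.instance Definition _ :=
  [SubIntegralDomain_isSubField of weight_field_type by <:].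

Lemma weight_field_weight i j : d i j \in weight_field.
Proof. by apply/weight_fieldP => S _; apply. Qed.

End GeneratedField.

Local Open Scope complex_scope.

Theorem proposition2p1 (R : realType) (d : 'I_3 -> 'I_3 -> R) (t : R)
    (d_01 : forall i j, 0 <= d i j <= 1)
    (d_sum : \sum_(i < 3) \sum_(j < 3) d i j = 1)
    (t_01 : 0 < t < 1)
    (t_tr : transcendental_over (in_generated_field d) t)
    (nondeg : nondegenerate_model (complex_weights d) t%:C) :
  let w := complex_weights d in
  let s := t%:C in
  [<-> kernel_curve_genus w s 0;
       singular_curve w s;
       exists! P, singularity w s P;
       exists P, [/\ on_curve w s P, is_root (Delta1 w s) P.1
                   & is_root (Delta2 w s) P.2];
       exists P, [/\ on_curve w s P, double_root (Delta1 w s) P.1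
                   & double_root (Delta2 w s) P.2]]
  /\ (kernel_curve_genus w s 0 -> forall P,
        singularity w s P <->
        double_root (Delta1 w s) P.1 /\ double_root (Delta2 w s) P.2)
  /\ (~ kernel_curve_genus w s 0 ->
        smooth_curve w s /\ kernel_curve_genus w s 1).
Proof.
move=> w s.
pose iota : {rmorphism weight_field_type d -> R[i]} :=
  real_complex R \o (val : weight_field_type d -> R).
have two0 : (2%:R : R[i]) != 0 by rewrite pnatr_eq0.
have w_alg i j : algebraicOver iota (w i j).
  exact: (algebraic_id iota (Sub (d i j) (weight_field_weight d i j) :
    weight_field_type d)).
have s_trans : ~ algebraicOver iota s.
  move=> [p p0]; rewrite map_poly_comp fmorph_root => pt.
  case/negP: p0; rewrite -(map_poly_eq0
    (val : {rmorphism weight_field_type d -> R})).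
  apply/eqP; apply: t_tr pt => i; rewrite coef_map.
  by apply/weight_fieldP; apply: (valP p`_i).
split; first exact: (genus0_equivalences two0 w_alg s_trans nondeg).
split; first exact: (genus0_singularity two0 w_alg s_trans nondeg).
exact: (genus1_otherwise two0 nondeg).
Qed.
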